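(* For every $n\ge3$ there is a connected smooth conformally flat metric on a slab in $\mathbb R^n$ satisfying the sectional sign trichotomy, with negative sectional curvature on one side of a flat hypersurface (a hypersurface along which $\operatorname{Rm}=0$) and positive sectional curvature on the other. If $d$ denotes distance to the hypersurface, then, as $d\to0$, $$\delta_{\mathrm{sec}}=e^{-1/d+o(1)}\quad\text{on the negative side},\qquad \delta_{\mathrm{sec}}=(4+o(1))\,d^4\quad\text{on the positive side}.$$ The asymptotics are uniform in the transverse variable on a fixed smaller slab.
   Context: Write points of $\mathbb R^n$ as $(t,z)\in\mathbb R\times\mathbb R^{n-1}$; a slab is a set $\{t_1<t<t_2,\ |z|<r\}$ with $t_1<0<t_2$ and $r>0$, the hypersurface is $\{t=0\}$ inside it, and $z$ is the transverse variable. Distance is with respect to the constructed metric. Here ''conformally flat'' means of the form $e^{2u}g_{\mathrm{Euc}}$. The unit round sphere has positive curvature; $\operatorname{Rm}$ is the Riemann curvature tensor. The sectional sign trichotomy: at every point $p$ either all sectional curvatures are $>0$, or all are $<0$, or $\operatorname{Rm}_p=0$. At a point with $\operatorname{Rm}_p\ne0$, $\delta_{\mathrm{sec}}(p)=\min_\sigma|K_p(\sigma)|/\max_\sigma|K_p(\sigma)|$ over $2$-planes $\sigma\subset T_pM$. *)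

(* Defs.v *)
From HB Require Import structures.
From mathcomp Require Import all_boot all_order all_algebra.
From mathcomp Require Import all_classical all_reals all_analysis.

Set Implicit Arguments.
Unset Strict Implicit.
Unset Printing Implicit Defensive.

Import Order.TTheory GRing.Theory Num.Theory.
Import numFieldNormedType.Exports.

Local Open Scope classical_set_scope.
Local Open Scope ring_scope.

Definition partial (R : realType) (n : nat) (i : 'I_n) (f : 'rV[R]_n -> R)
    (x : 'rV[R]_n) : R :=
  'D_(delta_mx 0 i : 'rV[R]_n) f x.

Definition iter_partial (R : realType) (n : nat) (s : seq 'I_n)
    (f : 'rV[R]_n -> R) : 'rV[R]_n -> R :=
  foldr (@partial R n) f s.

(* C^oo on an open set U: every iterated partial derivative is (Frechet)
   differentiable at every point of U. *)
Definition smooth_on (R : realType) (n : nat) (U : set 'rV[R]_n)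
    (f : 'rV[R]_n -> R) : Prop :=
  forall (s : seq 'I_n) (x : 'rV[R]_n), U x ->
    differentiable (iter_partial s f) x.

(* A metric is given by its matrix of components in the standard coordinates. *)
Definition conformal_metric (R : realType) (n : nat) (u : 'rV[R]_n -> R)
    (x : 'rV[R]_n) : 'M[R]_n :=
  (expR (2 * u x))%:M.

Definition inner (R : realType) (n : nat) (g : 'rV[R]_n -> 'M[R]_n)
    (x X Y : 'rV[R]_n) : R :=
  \sum_i \sum_j g x i j * X 0 i * Y 0 j.

(* Christoffel symbol Gamma^k_{ij} of the Levi-Civita connection. *)
Definition christoffel (R : realType) (n : nat) (g : 'rV[R]_n -> 'M[R]_n)
    (k i j : 'I_n) (x : 'rV[R]_n) : R :=
  2^-1 * \sum_l invmx (g x) k l *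
    (partial i (fun y => g y j l) x + partial j (fun y => g y i l) x
     - partial l (fun y => g y i j) x).

(* The component R^l_{ijk}, with R(e_i, e_j) e_k = sum_l R^l_{ijk} e_l and
   R(X, Y) Z = nabla_X nabla_Y Z - nabla_Y nabla_X Z - nabla_[X,Y] Z. *)
Definition curvature_coef (R : realType) (n : nat) (g : 'rV[R]_n -> 'M[R]_n)
    (l i j k : 'I_n) (x : 'rV[R]_n) : R :=
  partial i (christoffel g l j k) x - partial j (christoffel g l i k) x
  + \sum_m (christoffel g l i m x * christoffel g m j k x
            - christoffel g l j m x * christoffel g m i k x).

(* Rm(X, Y, Z, W) = g(R(X, Y) Z, W) at the point x. *)
Definition Rm (R : realType) (n : nat) (g : 'rV[R]_n -> 'M[R]_n)
    (x X Y Z W : 'rV[R]_n) : R :=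
  \sum_i \sum_j \sum_k \sum_l \sum_m
    curvature_coef g l i j k x * g x l m * X 0 i * Y 0 j * Z 0 k * W 0 m.

(* Curvature of the plane spanned by X and Y; with the conventions above the
   round sphere has K > 0. Meaningful for linearly independent X, Y only. *)
Definition sectional (R : realType) (n : nat) (g : 'rV[R]_n -> 'M[R]_n)
    (x X Y : 'rV[R]_n) : R :=
  Rm g x X Y Y X / (inner g x X X * inner g x Y Y - inner g x X Y ^+ 2).

Definition sec_pos (R : realType) (n : nat) (g : 'rV[R]_n -> 'M[R]_n)
    (x : 'rV[R]_n) : Prop :=
  forall X Y : 'rV[R]_n, free [:: X; Y] -> 0 < sectional g x X Y.

Definition sec_neg (R : realType) (n : nat) (g : 'rV[R]_n -> 'M[R]_n)
    (x : 'rV[R]_n) : Prop :=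
  forall X Y : 'rV[R]_n, free [:: X; Y] -> sectional g x X Y < 0.

Definition Rm_vanishes (R : realType) (n : nat) (g : 'rV[R]_n -> 'M[R]_n)
    (x : 'rV[R]_n) : Prop :=
  forall X Y Z W : 'rV[R]_n, Rm g x X Y Z W = 0.

Definition sign_trichotomy (R : realType) (n : nat) (g : 'rV[R]_n -> 'M[R]_n)
    (U : set 'rV[R]_n) : Prop :=
  forall x, U x -> [\/ sec_pos g x, sec_neg g x | Rm_vanishes g x].

Definition abs_sec_values (R : realType) (n : nat)
    (g : 'rV[R]_n -> 'M[R]_n) (x : 'rV[R]_n) : set R :=
  [set k | exists X Y : 'rV[R]_n,
      free [:: X; Y] /\ k = `|sectional g x X Y| ].

(* The inf and the sup are a min and a max: K is continuous on the compact
   Grassmannian of 2-planes. *)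
Definition delta_sec (R : realType) (n : nat) (g : 'rV[R]_n -> 'M[R]_n)
    (x : 'rV[R]_n) : R :=
  inf (abs_sec_values g x) / sup (abs_sec_values g x).

Definition curve_length (R : realType) (n : nat) (g : 'rV[R]_n -> 'M[R]_n)
    (c : R -> 'rV[R]_n) : R :=
  \int[@lebesgue_measure R]_(s in `[0, 1])
    Num.sqrt (inner g (c s) (derive1 c s) (derive1 c s)).

(* [curve_in g U p q L]: some piecewise C^1 curve inside U from p to q has
   g-length L. Pieces are C^1 curves on [0, 1], represented by C^1 maps on the
   whole line (a C^1 map on [0, 1] always extends). *)
Inductive curve_in (R : realType) (n : nat) (g : 'rV[R]_n -> 'M[R]_n)
    (U : set 'rV[R]_n) : 'rV[R]_n -> 'rV[R]_n -> R -> Prop :=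
| curve_piece (c : R -> 'rV[R]_n) :
    (forall s : R, derivable c s 1) -> continuous (derive1 c) ->
    (forall s : R, 0 <= s <= 1 -> U (c s)) ->
    curve_in g U (c 0) (c 1) (curve_length g c)
| curve_concat (p q r : 'rV[R]_n) (L1 L2 : R) :
    curve_in g U p q L1 -> curve_in g U q r L2 ->
    curve_in g U p r (L1 + L2).

(* Riemannian distance, in the manifold (U, g), from x to the set H. *)
Definition dist_to (R : realType) (n : nat) (g : 'rV[R]_n -> 'M[R]_n)
    (U H : set 'rV[R]_n) (x : 'rV[R]_n) : R :=
  inf [set L | exists q, H q /\ curve_in g U x q L].

Definition tcoord (R : realType) (n : nat) (p : 'rV[R]_n.+1) : R := p 0 ord0.

Definition zcoord (R : realType) (n : nat) (p : 'rV[R]_n.+1) : 'rV[R]_n :=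
  \row_i p 0 (lift ord0 i).

(* The library's norm on row vectors is the sup norm. *)
Definition euclidean_norm (R : realType) (n : nat) (z : 'rV[R]_n) : R :=
  Num.sqrt (\sum_i z 0 i ^+ 2).

Definition slab (R : realType) (n : nat) (t1 t2 r : R) : set 'rV[R]_n.+1 :=
  [set p | t1 < tcoord p < t2 /\ euclidean_norm (zcoord p) < r].

Definition hypersurface (R : realType) (n : nat) (t1 t2 r : R) :
    set 'rV[R]_n.+1 :=
  slab t1 t2 r `&` [set p | tcoord p = 0].

Definition neg_side (R : realType) (n : nat) (t1 t2 r : R) :
    set 'rV[R]_n.+1 :=
  slab t1 t2 r `&` [set p | tcoord p < 0].

Definition pos_side (R : realType) (n : nat) (t1 t2 r : R) :
    set 'rV[R]_n.+1 :=
  slab t1 t2 r `&` [set p | 0 < tcoord p].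

(* w = o(1) as d -> 0, uniformly over the points of A. *)
Definition o1_uniform (R : realType) (T : Type) (A : set T) (d w : T -> R) :
    Prop :=
  forall eps : R, 0 < eps -> exists2 eta : R, 0 < eta &
    forall p : T, A p -> d p < eta -> `|w p| < eps.

(* w = o(1) as d -> 0, for each fixed value of the transverse variable z. *)
Definition o1_pointwise (R : realType) (n : nat) (A : set 'rV[R]_n.+1)
    (d w : 'rV[R]_n.+1 -> R) : Prop :=
  forall z : 'rV[R]_n, o1_uniform (A `&` [set p | zcoord p = z]) d w.

(* Main.v *)
Require Import Defs.
From HB Require Import structures.
From mathcomp Require Import all_boot all_order all_algebra.
From mathcomp Require Import all_classical all_reals all_analysis.
From mathcomp Require Import ring lra.

(** A function of t alone cannot work for t > 0: with f = 1 + e^{-1/t}, planes containing d/dt have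
    K > 0 near t = 0, but planes orthogonal to d/dt have K = -|df|^2 < 0. The factor e^{|z|^2} cures
    this: it puts 2 into Hess w for each transverse direction, so that these planes gain (2 + 2) F,
    the origin of the constant 4. Since F is flat, |df|^2 = F^2 |dw|^2 is negligible against F. For
    t < 0 the term -|df|^2 already has the right sign. The obstacle is the entry -2 t^-3 of Hess w,
    which is unbounded and could destroy positivity on planes that are only nearly orthogonal to
    d/dt. It has to be absorbed by the part t^-4 of dw (x) dw, at a cost of O(t) in the remaining
    terms. The distance must be known beyond first order: 1/d sits in an exponent, so an error of
    order s^2 in d would change 1/d by a bounded amount that need not vanish. An error O(s^3) is
    enough. Dimension at least 3 provides planes orthogonal to d/dt, on which the least |K| for t <
    0 is attained. *)

(* With f = e^{-u}, the metric f^{-2} g_Euc has K(X,Y) = f (f_XX + f_YY) - |df|^2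
   on Euclidean-orthonormal pairs. We take f = 1 + e^{-1/t + |z|^2} for t > 0 and
   f = 1 - e^{1/t} for t < 0, which differ from 1 by terms flat at t = 0.

   For t = -s < 0 and f = 1 - phi(s), phi = e^{-1/s}, K is affine in the squared
   length q of the projection of d/dt to the plane: K = -(f phi'' q + phi'^2), so
   delta = phi'^2 / (f phi'' + phi'^2) = e^{-1/s} (1 + O(s)).

   For t > 0, write F = e^w with w = -1/t + |z|^2, so that
   Hess F = F (dw (x) dw + Hess w), dw = (t^-2, 2z), Hess w = diag(-2 t^-3, 2, .., 2).
   The largest curvatures are ~ F |dw|^2 ~ F t^-4; the smallest ones, on planes
   orthogonal to dw, are ~ 4 F; hence delta ~ 4 t^4.

   The distance to {t = 0} is |t| + O(|t|^3): t - t^3 is 1-Lipschitz for the metric,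
   and the segment with constant z gives the upper bound. *)

Set Implicit Arguments.
Unset Strict Implicit.
Unset Printing Implicit Defensive.

Import Order.TTheory GRing.Theory Num.Theory.
Import numFieldNormedType.Exports.

Local Open Scope classical_set_scope.
Local Open Scope ring_scope.

(** * Flat functions and smoothness *)

(** A derivative along [v] at [x] is the derivative at 0 of s |-> h (s v + x), so the one-variable
    chain rule is enough and only a directional derivative of [h] is assumed. *)
Lemma is_derive_comp1 (R : realType) (V : normedModType R) (h : V -> R)
    (phi : R -> R) (x v : V) (dh dphi : R) :
  is_derive x v h dh -> is_derive (h x) 1 phi dphi ->
  is_derive x v (phi \o h) (dphi * dh).
Proof.
move=> [dh1 dh2] dp.
have Q (k : V -> R) :
  (fun h0 : R => h0^-1 *: (((fun s : R => k (s *: v + x)) \o shift 0) (h0 *: 1) -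
      k (0 *: v + x))) = (fun h0 : R => h0^-1 *: ((k \o shift x) (h0 *: v) - k x)).
  by apply/funext => s /=; rewrite addr0 scale0r add0r [_%:A]mulr1.
have E (k : V -> R) y :
    is_derive x v k y <-> is_derive (0 : R) 1 (fun s : R => k (s *: v + x)) y.
  split=> -[d1 d2].
    by apply: DeriveDef; [exact: (derivable1P k x v).1 | rewrite -d2 /derive Q].
  by apply: DeriveDef; [exact: (derivable1P k x v).2 | rewrite -d2 /derive Q].
apply/E; apply: (@is_derive1_comp _ phi (fun s : R => h (s *: v + x))).
  by rewrite scale0r add0r.
exact/E.
Qed.

(** The powers of 1/t are included so that the family is closed under differentiation, up to linear
    combinations. *)
Definition flat_fun (R : realType) (k : nat) (t : R) : R :=
  if 0 < t then t^-1 ^+ k * expR (- t^-1) else 0.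

Section flat.
Context {R : realType}.
Implicit Types (k : nat) (t : R).

Lemma flat_pos k t : 0 < t -> flat_fun k t = t^-1 ^+ k * expR (- t^-1).
Proof. by rewrite /flat_fun => ->. Qed.

Lemma flat_npos k t : t <= 0 -> flat_fun k t = 0.
Proof. by rewrite /flat_fun ltNge => ->. Qed.

Lemma flat_ge0 k t : 0 <= flat_fun k t.
Proof.
rewrite /flat_fun; case: ifP => // t0.
by rewrite mulr_ge0 ?expR_ge0 ?exprn_ge0 // invr_ge0 ltW.
Qed.

Lemma flatS k t : flat_fun k t = t * flat_fun k.+1 t.
Proof.
rewrite /flat_fun; case: ifP => t0; last by rewrite mulr0.
by rewrite mulrA exprS mulrA mulfV ?mul1r // gt_eqF.
Qed.

(** The single term of order k + m + 1 in the exponential series at 1/t already dominates t^-k and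
    leaves t^(m+1) to spare. *)
Lemma flat_bound k m t : 0 <= t -> flat_fun k t <= (k + m).+1`!%:R * t ^+ m.+1.
Proof.
rewrite le_eqVlt => /predU1P[<-|t0].
  by rewrite flat_npos // exprS mul0r mulr0.
rewrite flat_pos // expRN ler_pdivrMr ?expR_gt0 // exprVn.
rewrite -[leLHS]mul1r ler_pdivrMr ?exprn_gt0 //.
have f0 : 0 < (k + m).+1`!%:R :> R by rewrite ltr0n fact_gt0.
have ti : 0 <= t^-1 by rewrite invr_ge0 ltW.
have := @expR_ge1Dxn R t^-1 (k + m) ti.
set e := expR _ => he.
have {}he : t^-1 ^+ (k + m).+1 / (k + m).+1`!%:R <= e by lra.
rewrite ler_pdivrMr // exprVn -[leLHS]mul1r ler_pdivrMr ?exprn_gt0 // in he.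
by rewrite -addnS exprD in he *; lra.
Qed.

Lemma is_derive_flat k t :
  is_derive t 1 (flat_fun k) (flat_fun k.+2 t - k%:R * flat_fun k.+1 t).
Proof.
have [t0|t0|->] := ltgtP t 0.
- rewrite !flat_npos ?ltW // mulr0 subrr.
  apply: (@near_eq_is_derive _ _ _ (cst 0)).
  near=> s; rewrite flat_npos // ltW //; near: s; exact: lt_nbhsl.
- rewrite !flat_pos //.
  have tn0 : t != 0 by rewrite gt_eqF.
  have dinv : is_derive t 1 (fun s : R => s^-1) (- t^-1 ^+ 2).
    apply: DeriveDef; first exact: derivableV.
    by rewrite (@deriveV _ _ id) //= derive_id -exprVn [_%:A]mulr1.
  have dN : is_derive t 1 (fun s : R => - s^-1) (t^-1 ^+ 2).
    by rewrite -[t^-1 ^+ 2]opprK; exact: is_deriveN.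
  have dX : is_derive t 1 (fun s : R => s^-1 ^+ k) (k%:R * t^-1 ^+ k.-1 * - t^-1 ^+ 2).
    have dp : is_derive t^-1 1 (fun s : R => s ^+ k) (k%:R * t^-1 ^+ k.-1).
      apply: DeriveDef; first exact: exprn_derivable.
      by rewrite exp_derive /GRing.scale /= mulr1.
    exact: (is_derive_comp1 dinv dp).
  have dE := is_derive_comp1 dN (is_derive_expR (- t^-1)).
  apply: (@near_eq_is_derive R R R _ _ t 1 _ _ (is_derive_eq (is_deriveM dX dE) _)).
    near=> s; rewrite flat_pos //; near: s; exact: lt_nbhsr.
  rewrite /GRing.scale /= !exprS.
  case: k {dX} => [|k] /=; first by rewrite !mul0r expr0; ring.
  rewrite !exprS; ring.
- rewrite !flat_npos // mulr0 subrr.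
  suff C : (fun h : R => h^-1 *: ((flat_fun k \o shift 0) (h *: 1) - flat_fun k 0)) @ 0^' --> (0 : R).
    by apply: DeriveDef; [apply/cvg_ex; exists 0 | exact/cvg_lim].
  apply/cvgrPdist_le => /= e e0.
  near=> h.
  have hn0 : h != 0 by near: h; exact: nbhs_dnbhs_neq.
  rewrite [_%:A]mulr1 addr0 (flat_npos _ (lexx 0)) // subr0 sub0r normrN.
  (* The difference quotient at 0 is [flat_fun k.+1 h], which [flat_bound] bounds by a multiple of h
     when h > 0. *)
  rewrite /GRing.scale /= [flat_fun k h]flatS mulrA mulVf // mul1r.
  rewrite ger0_norm ?flat_ge0 //.
  have [h0|h0] := leP h 0; first by rewrite flat_npos // ltW.
  apply: (le_trans (flat_bound _ 0 (ltW h0))).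
  rewrite addn0 expr1 -ler_pdivlMl ?ltr0n ?fact_gt0 //.
  rewrite (le_trans (ler_norm _)) //; near: h; apply: dnbhs0_le.
  by rewrite mulr_gt0 // invr_gt0 ltr0n fact_gt0.
Unshelve. all: by end_near. Qed.

End flat.

(** A class of expressions containing the conformal factor and closed under directional derivatives,
    so that smoothness reduces to differentiability of its members. The side conditions on inverse
    and logarithm are global because iterated partials are identified as functions on the whole
    space. *)
Inductive elementary (R : realType) (n : nat) : ('rV[R]_n -> R) -> Prop :=
| elementary_cst c : elementary (fun=> c)
| elementary_coord i : elementary (fun p => p 0 i)
| elementary_flat k h : elementary h ->
    elementary (fun p => flat_fun k (h p))
| elementary_add h1 h2 : elementary h1 -> elementary h2 ->
    elementary (fun p => h1 p + h2 p)
| elementary_mul h1 h2 : elementary h1 -> elementary h2 ->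
    elementary (fun p => h1 p * h2 p)
| elementary_exp h : elementary h -> elementary (fun p => expR (h p))
| elementary_inv h : elementary h -> (forall p, h p != 0) ->
    elementary (fun p => (h p)^-1)
| elementary_ln h : elementary h -> (forall p, 0 < h p) ->
    elementary (fun p => ln (h p)).

Section elementary_smooth.
Context {R : realType} {n : nat}.
Implicit Types (h : 'rV[R]_n -> R).

Lemma differentiable_comp1 h (phi : R -> R) x dphi :
  differentiable h x -> is_derive (h x) 1 phi dphi ->
  differentiable (fun p => phi (h p)) x.
Proof.
move=> dh [dp _]; apply: (@differentiable_comp _ _ _ _ h phi) => //.
exact/derivable1_diffP.
Qed.

Lemma elementary_differentiable h x : elementary h -> differentiable h x.
Proof.
elim=> {h} [c|i|k h _ dh|h1 h2 _ d1 _ d2|h1 h2 _ d1 _ d2|h _ dh|h _ dh h0|h _ dh h0].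
- exact: differentiable_cst.
- exact: differentiable_coord.
- exact: differentiable_comp1 dh (is_derive_flat _ _).
- exact: differentiableD.
- exact: differentiableM.
- exact: differentiable_comp1 dh (is_derive_expR _).
- exact: differentiableV.
- exact: differentiable_comp1 dh (is_derive1_ln (h0 _)).
Qed.

Lemma is_derive_coord (x v : 'rV[R]_n) i :
  is_derive x v (fun p : 'rV[R]_n => p 0 i) (v 0 i).
Proof.
apply: DeriveDef; first exact/diff_derivable/differentiable_coord.
have := @derive_mx R _ 1 n id x v (@derivable_id _ _ _ _).
by move/matrixP => /(_ 0 i); rewrite mxE derive_id.
Qed.

Lemma is_deriveVv h x v dh : h x != 0 -> is_derive x v h dh ->
  is_derive x v (fun p => (h p)^-1) (- (h x) ^- 2 * dh).
Proof.
move=> h0 [d1 d2]; apply: DeriveDef; first exact: derivableV.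
by rewrite deriveV // d2.
Qed.

Lemma elementary_derive h v : elementary h ->
  exists2 h', elementary h' & forall x, is_derive x v h (h' x).
Proof.
elim=> {h} [c|i|k h eh [h' eh' d]|h1 h2 e1 [h1' e1' d1] e2 [h2' e2' d2]
  |h1 h2 e1 [h1' e1' d1] e2 [h2' e2' d2]|h eh [h' eh' d]|h eh [h' eh' d] h0|h eh [h' eh' d] h0].
- by exists (fun=> 0) => [|x]; [exact: elementary_cst | exact: is_derive_cst].
- by exists (fun=> v 0 i) => [|x]; [exact: elementary_cst | exact: is_derive_coord].
- exists (fun x => (flat_fun k.+2 (h x) + (- k%:R) * flat_fun k.+1 (h x)) * h' x) => [|x].
    by do ?[apply: elementary_mul|apply: elementary_add|apply: elementary_flat
      |apply: elementary_cst].
  rewrite mulNr.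
  exact: is_derive_comp1 (d x) (is_derive_flat _ _).
- exists (fun x => h1' x + h2' x) => [|x]; first exact: elementary_add.
  exact: is_deriveD.
- exists (fun x => h1 x * h2' x + h2 x * h1' x) => [|x].
    by apply: elementary_add; apply: elementary_mul.
  exact: is_deriveM.
- exists (fun x => expR (h x) * h' x) => [|x].
    by apply: elementary_mul => //; apply: elementary_exp.
  exact: is_derive_comp1 (d x) (is_derive_expR _).
- exists (fun x => (-1) * ((h x)^-1 * (h x)^-1) * h' x) => [|x].
    by do ?[apply: elementary_mul|apply: elementary_inv|apply: elementary_cst].
  rewrite mulN1r -invfM -expr2.
  exact: is_deriveVv.
- exists (fun x => (h x)^-1 * h' x) => [|x].
    apply: elementary_mul => //; apply: elementary_inv => // p.
    by rewrite gt_eqF.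
  exact: is_derive_comp1 (d x) (is_derive1_ln (h0 _)).
Qed.

Lemma elementary_smooth U h : elementary h -> smooth_on U h.
Proof.
move=> eh s x _; apply: elementary_differentiable.
elim: s => //= i s /(elementary_derive (delta_mx 0 i))[h' eh' d].
suff -> : partial i (iter_partial s h) = h' by [].
by apply/funext => p; rewrite /partial derive_val.
Qed.

End elementary_smooth.

(** * Curvature of a conformally flat metric *)

Definition dotmul (R : realType) n (x y : 'rV[R]_n) : R :=
  \sum_i x 0 i * y 0 i.

Definition quad (R : realType) n (b : 'I_n -> 'I_n -> R) (x y : 'rV[R]_n) : R :=
  \sum_i \sum_j b i j * x 0 i * y 0 j.

Definition gram (R : realType) n (x y : 'rV[R]_n) : R :=
  dotmul x x * dotmul y y - dotmul x y ^+ 2.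

(* The Kulkarni-Nomizu product of [b] with the Euclidean metric, evaluated on
   the plane spanned by [x] and [y]. *)
Definition kn (R : realType) n (b : 'I_n -> 'I_n -> R) (x y : 'rV[R]_n) : R :=
  quad b x x * dotmul y y + quad b y y * dotmul x x
  - 2 * quad b x y * dotmul x y.

Section curvature.
Context {R : realType} {n : nat}.
Implicit Types (i j k l m : 'I_n).

Lemma sum_delta (F : 'I_n -> R) i : \sum_m (m == i)%:R * F m = F i.
Proof.
rewrite (bigD1 i) //= eqxx mul1r big1 ?addr0 // => m /negbTE ->.
by rewrite mul0r.
Qed.

Lemma sum_delta_sym (F : 'I_n -> R) i : \sum_m (i == m)%:R * F m = F i.
Proof. by rewrite -[RHS]sum_delta; apply: eq_bigr => m _; rewrite eq_sym. Qed.

Variables (f : 'rV[R]_n -> R) (f1 : 'I_n -> 'rV[R]_n -> R)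
  (f2 : 'I_n -> 'I_n -> 'rV[R]_n -> R).
Hypothesis f_gt0 : forall x, 0 < f x.
Hypothesis df : forall i x, is_derive x (delta_mx 0 i) f (f1 i x).
Hypothesis df1 : forall i j x, is_derive x (delta_mx 0 j) (f1 i) (f2 i j x).
Hypothesis f2C : forall i j x, f2 i j x = f2 j i x.

Let u x := - ln (f x).
Let g := conformal_metric u.

Lemma conformalE x i j : g x i j = (i == j)%:R * (f x)^-1 ^+ 2.
Proof.
by rewrite /g /conformal_metric mxE /u mulrN expRN expRM_natl lnK ?posrE // exprVn mulr_natl.
Qed.

(** [w] is d(log f) = -du, while [T] is Hess f / f rather than Hess(log f): the difference, a
    product of two [w], is what cancels in the curvature. *)
Let w i x := f1 i x / f x.
Let w2 x := \sum_i w i x ^+ 2.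
Let T i j x := f2 i j x / f x.

Lemma fV_neq0 x : f x != 0. Proof. by rewrite gt_eqF. Qed.

Lemma partial_conformal i j k x :
  partial k (fun y => g y i j) x = (i == j)%:R * (-2 * w k x * (f x)^-1 ^+ 2).
Proof.
have -> : (fun y => g y i j) = (fun y => (i == j)%:R * ((f y)^-1 * (f y)^-1)).
  by apply/funext => y; rewrite conformalE expr2.
have dV := is_deriveVv (fV_neq0 x) (df k x).
have dM := is_deriveM dV dV.
rewrite /partial (@derive_val _ _ _ _ _ _ _ (is_deriveZ (i == j)%:R dM)).
rewrite /GRing.scale /= /w; congr (_ * _); have := fV_neq0 x => f0.
by field.
Qed.

Lemma christoffel_conformal k i j x :
  christoffel g k i j x = (i == j)%:R * w k x - (k == j)%:R * w i x - (k == i)%:R * w j x.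
Proof.
rewrite /christoffel /g /conformal_metric invmx_scalar -/(conformal_metric _) -/g.
have -> : (expR (2 * u x))^-1 = f x ^+ 2.
  by rewrite /u mulrN expRN invrK expRM_natl lnK ?posrE.
under eq_bigr => l _.
  rewrite !partial_conformal mxE -[_ *+ _]mulr_natl -mulrA.
  over.
rewrite /= (sum_delta_sym (fun l => f x ^+ 2 * _)).
rewrite (eq_sym j k) (eq_sym i k); have := fV_neq0 x => f0.
by field.
Qed.

Lemma partial_w i k x : partial k (w i) x = T i k x - w i x * w k x.
Proof.
have dV := is_deriveVv (fV_neq0 x) (df k x).
rewrite /partial (@derive_val _ _ _ _ _ _ _ (is_deriveM (df1 i k x) dV)).
rewrite /GRing.scale /= /w /T; have := fV_neq0 x => f0.
by field.
Qed.

Lemma derivable_w i x v : derivable f x v -> derivable (f1 i) x v -> derivable (w i) x v.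
Proof. by move=> d d1; exact: (derivableM d1 (derivableV (fV_neq0 x) d)). Qed.

Lemma partial_christoffel i l j k x :
  partial i (christoffel g l j k) x =
  (j == k)%:R * (T l i x - w l x * w i x)
  - (l == k)%:R * (T j i x - w j x * w i x)
  - (l == j)%:R * (T k i x - w k x * w i x).
Proof.
have -> : christoffel g l j k =
    (fun y => (j == k)%:R *: w l y - (l == k)%:R *: w j y - (l == j)%:R *: w k y).
  by apply/funext => y; rewrite christoffel_conformal.
have dw a : is_derive x (delta_mx 0 i) (w a) (T a i x - w a x * w i x).
  apply: DeriveDef; last exact: partial_w.
  by apply: derivable_w; apply: ex_derive.
rewrite /partial.
by rewrite (@derive_val _ _ _ _ _ _ _ (is_deriveB (is_deriveB (is_deriveZ _ (dw l))
  (is_deriveZ _ (dw j))) (is_deriveZ _ (dw k)))).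
Qed.

Lemma christoffel_sum i l j k x :
  \sum_m christoffel g l i m x * christoffel g m j k x =
  w l x * christoffel g i j k x - w i x * christoffel g l j k x
  - (l == i)%:R * ((j == k)%:R * w2 x - 2 * w j x * w k x).
Proof.
have E m : christoffel g l i m x * christoffel g m j k x =
    (i == m)%:R * (w l x * christoffel g m j k x)
    - (l == m)%:R * (w i x * christoffel g m j k x)
    - (l == i)%:R * ((j == k)%:R * w m x ^+ 2 - (m == k)%:R * (w j x * w m x)
        - (m == j)%:R * (w k x * w m x)).
  by rewrite (christoffel_conformal l i m) (christoffel_conformal m j k); ring.
rewrite (eq_bigr _ (fun m _ => E m)) !sumrB !sum_delta_sym -mulr_sumr !sumrB.
by rewrite -mulr_sumr !sum_delta -/(w2 x); ring.
Qed.

(** Antisymmetrising in i and j cancels the products [w i * w j] from differentiating [w] against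
    those from the quadratic Christoffel terms. Only Hess f / f and |w|^2 survive. *)
Lemma curvature_conformal l i j k x :
  curvature_coef g l i j k x =
  (l == i)%:R * T j k x - (l == j)%:R * T i k x
  + (j == k)%:R * T i l x - (i == k)%:R * T j l x
  - ((l == i)%:R * (j == k)%:R - (l == j)%:R * (i == k)%:R) * w2 x.
Proof.
rewrite /curvature_coef !partial_christoffel sumrB !christoffel_sum.
rewrite !christoffel_conformal.
have TC a b : T a b x = T b a x by rewrite /T f2C.
rewrite (TC k j) (TC k i) (TC l i) (TC l j) (TC j i) (eq_sym j i).
ring.
Qed.

Lemma Rm_conformal0 x : (forall i, f1 i x = 0) -> (forall i j, f2 i j x = 0) ->
  Rm_vanishes g x.
Proof.
move=> z1 z2 X Y Z W; rewrite /Rm big1 // => i _; rewrite big1 // => j _.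
rewrite big1 // => k _; rewrite big1 // => l _; rewrite big1 // => m _.
rewrite curvature_conformal /T /w2 /w !z2 big1 => [|a _]; last by rewrite z1 mul0r expr0n.
by ring.
Qed.

(** The five-term shape of [curvature_conformal] persists through the four contractions over l, k, j
    and i in [Rm_conformal]. *)
Lemma sum_lin5 (a b c d e : R) (F1 F2 F3 F4 F5 : 'I_n -> R) :
  \sum_i (a * F1 i - b * F2 i + c * F3 i - d * F4 i - e * F5 i) =
  a * (\sum_i F1 i) - b * (\sum_i F2 i) + c * (\sum_i F3 i) - d * (\sum_i F4 i)
  - e * (\sum_i F5 i).
Proof. by rewrite !sumrB big_split /= sumrB -!mulr_sumr. Qed.

Lemma inner_conformal x (X Y : 'rV[R]_n) :
  inner g x X Y = (f x)^-1 ^+ 2 * dotmul X Y.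
Proof.
rewrite /inner /dotmul mulr_sumr; apply: eq_bigr => i _.
under eq_bigr do rewrite conformalE -!mulrA.
by rewrite sum_delta_sym mulrA.
Qed.

Lemma dotmulC (X Y : 'rV[R]_n) : dotmul X Y = dotmul Y X.
Proof. by apply: eq_bigr => i _; rewrite mulrC. Qed.

Lemma Rm_conformal x (X Y : 'rV[R]_n) :
  Rm g x X Y Y X = (f x)^-1 ^+ 2 *
   (kn (fun i j => f2 i j x) X Y / f x - gram X Y * (\sum_i f1 i x ^+ 2) / f x ^+ 2).
Proof.
pose c := (f x)^-1 ^+ 2.
pose TV (V : 'rV[R]_n) i := \sum_l T i l x * V 0 l.
have TC a b : T a b x = T b a x by rewrite /T f2C.
have TVE (V W : 'rV[R]_n) : \sum_i TV V i * W 0 i = quad (fun i j => f2 i j x) W V / f x.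
  rewrite /quad mulr_suml; apply: eq_bigr => i _.
  rewrite !mulr_suml; apply: eq_bigr => l _; rewrite /T.
  by rewrite -!mulrA; congr (_ * _); ring.
have quadC : quad (fun i j => f2 i j x) Y X = quad (fun i j => f2 i j x) X Y.
  rewrite /quad exchange_big /=; apply: eq_bigr => i _; apply: eq_bigr => j _.
  by rewrite f2C; ring.
have w2E : w2 x = (\sum_i f1 i x ^+ 2) / f x ^+ 2.
  by rewrite mulr_suml; apply: eq_bigr => i _; rewrite /w expr_div_n.
(* The sums are contracted from the inside out: m through the diagonal metric, then l, k, j, i, each
   absorbing its Kronecker deltas. *)
have S1 i j k : \sum_l \sum_m curvature_coef g l i j k x * g x l m *
      X 0 i * Y 0 j * Y 0 k * X 0 m =
    c * X 0 i * Y 0 j * (Y 0 k * (X 0 i * T j k x - X 0 j * T i k x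
      + (j == k)%:R * TV X i - (i == k)%:R * TV X j
      - (X 0 i * (j == k)%:R - X 0 j * (i == k)%:R) * w2 x)).
  under eq_bigr => l _.
    under eq_bigr => m _.
      have -> : curvature_coef g l i j k x * g x l m *
        X 0 i * Y 0 j * Y 0 k * X 0 m = (l == m)%:R *
        (c * X 0 i * Y 0 j * Y 0 k * (curvature_coef g l i j k x * X 0 m)).
        by rewrite conformalE -/c; ring.
      over.
    rewrite sum_delta_sym.
    over.
  rewrite -mulr_sumr mulrA; congr (_ * _).
  under eq_bigr => l _.
    have -> : curvature_coef g l i j k x * X 0 l =
       T j k x * ((l == i)%:R * X 0 l) - T i k x * ((l == j)%:R * X 0 l)
       + (j == k)%:R * (T i l x * X 0 l) - (i == k)%:R * (T j l x * X 0 l)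
       - w2 x * ((j == k)%:R * ((l == i)%:R * X 0 l) - (i == k)%:R * ((l == j)%:R * X 0 l)).
      by rewrite curvature_conformal; ring.
    over.
  rewrite sum_lin5 sumrB -!mulr_sumr !sum_delta -/(TV X i) -/(TV X j); ring.
have S2 i j : \sum_k \sum_l \sum_m curvature_coef g l i j k x * g x l m *
      X 0 i * Y 0 j * Y 0 k * X 0 m =
    c * X 0 i * (Y 0 j * (X 0 i * TV Y j - X 0 j * TV Y i + Y 0 j * TV X i - Y 0 i * TV X j
     - (X 0 i * Y 0 j - X 0 j * Y 0 i) * w2 x)).
  rewrite (eq_bigr _ (fun k _ => S1 i j k)) -mulr_sumr mulrA; congr (_ * _).
  under eq_bigr => k _.
    have -> : Y 0 k * (X 0 i * T j k x - X 0 j * T i k x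
      + (j == k)%:R * TV X i - (i == k)%:R * TV X j
      - (X 0 i * (j == k)%:R - X 0 j * (i == k)%:R) * w2 x) =
      X 0 i * (T j k x * Y 0 k) - X 0 j * (T i k x * Y 0 k)
      + TV X i * ((j == k)%:R * Y 0 k) - TV X j * ((i == k)%:R * Y 0 k)
      - w2 x * (X 0 i * ((j == k)%:R * Y 0 k) - X 0 j * ((i == k)%:R * Y 0 k)).
      ring.
    over.
  rewrite sum_lin5 sumrB -!mulr_sumr !sum_delta_sym -/(TV Y i) -/(TV Y j); ring.
have S3 i : \sum_j \sum_k \sum_l \sum_m curvature_coef g l i j k x * g x l m *
      X 0 i * Y 0 j * Y 0 k * X 0 m =
    c * (X 0 i * (X 0 i * (\sum_j TV Y j * Y 0 j) - dotmul X Y * TV Y i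
     + dotmul Y Y * TV X i - Y 0 i * (\sum_j TV X j * Y 0 j)
     - (X 0 i * dotmul Y Y - dotmul X Y * Y 0 i) * w2 x)).
  rewrite (eq_bigr _ (fun j _ => S2 i j)) -mulr_sumr mulrA; congr (_ * _).
  under eq_bigr => j _.
    have -> : Y 0 j * (X 0 i * TV Y j - X 0 j * TV Y i + Y 0 j * TV X i - Y 0 i * TV X j
     - (X 0 i * Y 0 j - X 0 j * Y 0 i) * w2 x) =
      X 0 i * (TV Y j * Y 0 j) - TV Y i * (X 0 j * Y 0 j)
      + TV X i * (Y 0 j * Y 0 j) - Y 0 i * (TV X j * Y 0 j)
      - w2 x * (X 0 i * (Y 0 j * Y 0 j) - Y 0 i * (X 0 j * Y 0 j)).
      ring.
    over.
  rewrite sum_lin5 sumrB -!mulr_sumr -/(dotmul X Y) -/(dotmul Y Y); ring.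
rewrite /Rm (eq_bigr _ (fun i _ => S3 i)) -mulr_sumr; congr (_ * _).
under eq_bigr => i _.
  have -> : X 0 i * (X 0 i * (\sum_j TV Y j * Y 0 j) - dotmul X Y * TV Y i
     + dotmul Y Y * TV X i - Y 0 i * (\sum_j TV X j * Y 0 j)
     - (X 0 i * dotmul Y Y - dotmul X Y * Y 0 i) * w2 x) =
     (\sum_j TV Y j * Y 0 j) * (X 0 i * X 0 i) - dotmul X Y * (TV Y i * X 0 i)
     + dotmul Y Y * (TV X i * X 0 i) - (\sum_j TV X j * Y 0 j) * (X 0 i * Y 0 i)
     - w2 x * (dotmul Y Y * (X 0 i * X 0 i) - dotmul X Y * (X 0 i * Y 0 i)).
    ring.
  over.
rewrite sum_lin5 sumrB -!mulr_sumr -/(dotmul X Y) -/(dotmul X X) !TVE quadC w2E.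
rewrite /kn /gram; have := fV_neq0 x => f0.
by field.
Qed.

Lemma sectional_conformal x (X Y : 'rV[R]_n) : gram X Y != 0 ->
  sectional g x X Y =
  f x * (kn (fun i j => f2 i j x) X Y / gram X Y) - \sum_i f1 i x ^+ 2.
Proof.
move=> D0; rewrite /sectional Rm_conformal !inner_conformal.
set c := _ ^+ 2; rewrite (_ : c * dotmul X X * (c * dotmul Y Y) - (c * dotmul X Y) ^+ 2 = c ^+ 2 * gram X Y); last by rewrite /gram; ring.
rewrite /c.
by have := fV_neq0 x => f0; field; rewrite f0 D0.
Qed.

Lemma dotmul_ge0 (X : 'rV[R]_n) : 0 <= dotmul X X.
Proof. by apply: sumr_ge0 => i _; rewrite -expr2 sqr_ge0. Qed.

Lemma dotmul_gt0 (X : 'rV[R]_n) : X != 0 -> 0 < dotmul X X.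
Proof.
move=> X0; rewrite lt_neqAle dotmul_ge0 andbT eq_sym.
apply: contra X0; rewrite psumr_eq0 => [/allP h|i _]; last by rewrite -expr2 sqr_ge0.
apply/eqP/rowP => i; rewrite mxE; have /= := h i (mem_index_enum _).
by rewrite -expr2 sqrf_eq0 => /eqP.
Qed.

Lemma dotmulDl a b (X Y Z : 'rV[R]_n) :
  dotmul (a *: X + b *: Y) Z = a * dotmul X Z + b * dotmul Y Z.
Proof.
rewrite /dotmul !mulr_sumr -big_split; apply: eq_bigr => i _.
by rewrite !mxE /=; ring.
Qed.

Lemma dotmulDr a b (X Y Z : 'rV[R]_n) :
  dotmul Z (a *: X + b *: Y) = a * dotmul Z X + b * dotmul Z Y.
Proof. by rewrite dotmulC dotmulDl ![dotmul _ Z]dotmulC. Qed.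

(** Strict Cauchy-Schwarz: |Y|^2 X - (X.Y) Y is nonzero by independence, and its squared length is
    |Y|^2 times the Gram determinant. *)
Lemma gram_gt0 (X Y : 'rV[R]_n) : free [:: X; Y] -> 0 < gram X Y.
Proof.
rewrite free_cons span_seq1 => /andP[XY].
rewrite free_cons span_nil memv0 => /andP[Y0 _].
have := dotmul_gt0 Y0; set yy := dotmul Y Y => yy0.
have : dotmul Y Y *: X + (- dotmul X Y) *: Y != 0.
  apply: contra XY => /eqP e; apply/vlineP; exists (dotmul X Y / yy).
  move/eqP: e; rewrite scaleNr subr_eq0 => /eqP e.
  by rewrite mulrC -scalerA -e scalerA mulVf ?scale1r // gt_eqF.
move=> /dotmul_gt0; rewrite !(dotmulDl, dotmulDr) -/yy (dotmulC Y X).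
have -> : yy * (yy * dotmul X X + - dotmul X Y * dotmul X Y)
  + - dotmul X Y * (yy * dotmul X Y + - dotmul X Y * yy) = yy * gram X Y.
  by rewrite /gram -/yy; ring.
by rewrite pmulr_rgt0.
Qed.

End curvature.

(** * Lengths and distance *)

Section curves.
Context {R : realType} {n : nat}.
Notation V := 'rV[R]_n.+1.
Variable f : V -> R.
Hypothesis f_gt0 : forall x, 0 < f x.
Hypothesis f_cont : continuous f.

Let g := conformal_metric (fun x => - ln (f x)).
Let mu := @lebesgue_measure R.

Lemma continuous_sum_seq (T : topologicalType) (I : Type) (r : seq I) (F : I -> T -> R) :
  (forall i, continuous (F i)) -> continuous (fun s => \sum_(i <- r) F i s).
Proof.
move=> cF; elim: r => [|i r IH] x.
  rewrite (_ : (fun s => _) = (fun=> 0)); first exact: cvg_cst.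
  by apply/funext => s; rewrite big_nil.
rewrite (_ : (fun s => _) = (fun s => F i s + \sum_(j <- r) F j s)).
  by apply: cvgD; [exact: cF | exact: IH].
by apply/funext => s; rewrite big_cons.
Qed.

Lemma speedE (c : R -> V) s :
  Num.sqrt (inner g (c s) (derive1 c s) (derive1 c s)) =
  (f (c s))^-1 * Num.sqrt (dotmul (derive1 c s) (derive1 c s)).
Proof.
rewrite (inner_conformal f_gt0) sqrtrM ?sqr_ge0 // sqrtr_sqr ger0_norm //.
by rewrite invr_ge0 ltW.
Qed.

Lemma speed_continuous (c : R -> V) :
  (forall s : R, derivable c s 1) -> continuous (derive1 c) ->
  continuous (fun s => Num.sqrt (inner g (c s) (derive1 c s) (derive1 c s))).
Proof.
move=> dc cc.
rewrite (_ : (fun s => _) = (fun s =>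
  (f (c s))^-1 * Num.sqrt (dotmul (derive1 c s) (derive1 c s)))); last first.
  by apply/funext => s; exact: speedE.
move=> s; apply: cvgM.
  apply: cvgV; first by rewrite gt_eqF.
  apply: (continuous_comp _ (f_cont (x := c s))).
  by apply/differentiable_continuous; apply/derivable1_diffP.
apply: (@continuous_comp _ _ _ (fun s => dotmul (derive1 c s) (derive1 c s))
  (@Num.sqrt R)); last exact: sqrt_continuous.
apply: continuous_sum_seq => i r.
by apply: cvgM; apply: (continuous_comp (cc r) (@coord_continuous _ _ _ _ _ _)).
Qed.

Lemma integrable_01 (h : R -> R) : continuous h -> mu.-integrable `[0, 1] (EFin \o h).
Proof.
move=> ch; apply: continuous_compact_integrable; first exact: segment_compact.
exact: continuous_subspaceT.
Qed.

Lemma derive1_coord (c : R -> V) s i : derivable c s 1 ->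
  is_derive s 1 (fun r => c r 0 i) (derive1 c s 0 i).
Proof.
move=> dc; apply: DeriveDef; first exact: (derivable_mxP c s 1).1.
by rewrite derive1E derive_mx // mxE.
Qed.

Lemma coord_le_dotmul (v : V) i : `|v 0 i| <= Num.sqrt (dotmul v v).
Proof.
rewrite -sqrtr_sqr ler_wsqrtr // /dotmul (bigD1 i) //= -expr2 lerDl.
by apply: sumr_ge0 => j _; rewrite -expr2 sqr_ge0.
Qed.

(** In the metric f^-2 g_Euc the gradient of G(t) has norm f |G'|. The bound by 1 makes the
    derivative of G(t) along the curve at most the speed, and the fundamental theorem of calculus
    concludes. *)
Lemma piece_length_ge (U : set V) (G dG : R -> R) (c : R -> V) :
  (forall s : R, is_derive s 1 G (dG s)) -> continuous dG ->
  (forall x, U x -> `|dG (tcoord x)| * f x <= 1) ->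
  (forall s : R, derivable c s 1) -> continuous (derive1 c) ->
  (forall s : R, 0 <= s <= 1 -> U (c s)) ->
  G (tcoord (c 1)) - G (tcoord (c 0)) <= curve_length g c.
Proof.
move=> dGP cdG GU dc cc cU.
pose F s := G (tcoord (c s)).
pose F' s := dG (tcoord (c s)) * derive1 c s 0 ord0.
have dF (s : R) : is_derive s 1 F (F' s).
  exact: (is_derive1_comp (f := G) (g := fun s => c s 0 ord0)
    (dGP _) (derive1_coord ord0 (dc s))).
have ctc : continuous (fun s => tcoord (c s)).
  move=> s; apply/differentiable_continuous/derivable1_diffP.
  by have [] := derive1_coord ord0 (dc s).
have cF' : continuous F'.
  move=> s; apply: cvgM.
    exact: (continuous_comp (ctc s) (cdG _)).
  exact: (continuous_comp (cc s) (@coord_continuous _ _ _ _ _ _)).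
have cF : continuous F.
  by move=> s; apply/differentiable_continuous/derivable1_diffP; have [] := dF s.
have E : \int[mu]_(s in `[0, 1]) F' s = F 1 - F 0.
  rewrite /Rintegral (@continuous_FTC2 _ F' F 0 1 ltr01) //.
  - exact: continuous_subspaceT.
  - split.
    + by move=> s _; have [] := dF s.
    + exact/cvg_at_right_filter/cF.
    + exact/cvg_at_left_filter/cF.
  - by move=> s _; rewrite derive1E derive_val.
rewrite -/(F 1) -/(F 0) -E /curve_length; apply: le_Rintegral => //.
- exact: integrable_01.
- by apply: integrable_01; exact: speed_continuous.
move=> s; rewrite /= in_itv /= => s01; rewrite speedE /F'.
apply: (le_trans (ler_norm _)); rewrite normrM.
apply: ler_pM => //; last exact: coord_le_dotmul.
by rewrite -[leRHS]mul1r ler_pdivlMr //; apply/GU/cU.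
Qed.

Lemma curve_length_ge (U : set V) (G dG : R -> R) (p q : V) L :
  (forall s : R, is_derive s 1 G (dG s)) -> continuous dG ->
  (forall x, U x -> `|dG (tcoord x)| * f x <= 1) ->
  curve_in g U p q L -> `|G (tcoord q) - G (tcoord p)| <= L.
Proof.
move=> dGP cdG GU; elim=> {p q L} [c dc cc cU|p q r L1 L2 _ h1 _ h2].
  rewrite ler_norml lerNl; apply/andP; split; last exact: (piece_length_ge (U := U) dGP).
  (* The other sign of the absolute value is the same estimate for -G. *)
  pose G' s := - G s; rewrite opprB -[G _]opprK addrC -/(G' _) -/(G' (tcoord (c 0))).
  apply: (piece_length_ge (U := U) (dG := fun s => - dG s)) => //.
  - by move=> s; apply: cvgN; apply: cdG.
  - by move=> x Ux; rewrite normrN; exact: GU.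
apply: le_trans (lerD h1 h2); rewrite [leRHS]addrC.
by apply: le_trans (ler_normD _ _); rewrite addrA subrK.
Qed.

(** The straight segment with constant z from [p], at s = 0, to its foot on {t = 0}, at s = 1. *)
Definition flatten_t (p : V) (s : R) : V := p + s *: (- tcoord p *: delta_mx 0 ord0).

Lemma segment_length (U : set V) (p : V) (M : R) :
  (forall s, 0 <= s <= 1 -> U (flatten_t p s) /\ (f (flatten_t p s))^-1 <= M) ->
  exists2 L, curve_in g U p (flatten_t p 1) L & L <= M * `|tcoord p|.
Proof.
move=> H; pose v : V := - tcoord p *: delta_mx 0 ord0.
pose c := flatten_t p.
have dc (s : R) : is_derive s 1 c v.
  have d1 : is_derive s 1 (fun r : R => r *: v) v.
    apply: DeriveDef.
      by apply/derivable1_diffP; apply: differentiableZl.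
    rewrite deriveE ?diff_val ?scale1r //; exact: differentiableZl.
  rewrite -[v]add0r; apply: is_deriveD.
have c'E : derive1 c = (fun=> v).
  by apply/funext => s; rewrite derive1E derive_val.
have ccv : continuous (derive1 c) by rewrite c'E => s; apply: cvg_cst.
have dcd (s : R) : derivable c s 1 by have [] := dc s.
exists (curve_length g c).
  have {1}-> : p = c 0 by rewrite /c /flatten_t scale0r addr0.
  by apply: curve_piece => // s /H[].
have vE : Num.sqrt (dotmul v v) = `|tcoord p|.
  rewrite -sqrtr_sqr; congr Num.sqrt; rewrite /dotmul (bigD1 ord0) //= big1 => [|i i0].
    by rewrite addr0 !mxE /= mulr1 mulrNN.
  by rewrite !mxE (negbTE i0) andbF mulr0 mul0r.
rewrite /curve_length.
apply: (@le_trans _ _ (\int[mu]_(s in `[0, 1]) (M * `|tcoord p|))).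
  apply: le_Rintegral => //.
  - by apply: integrable_01; exact: speed_continuous.
  - by apply: integrable_01 => s; exact: cvg_cst.
  - move=> s; rewrite /= in_itv /= => s01; rewrite speedE c'E vE.
    by rewrite ler_wpM2r //; have [] := H s s01.
rewrite Rintegral_cst // (_ : fine _ = 1) ?mulr1 //.
by have /= -> := @lebesgue_measure_itv R `[0, 1]; rewrite lte_fin ltr01 oppr0 adde0.
Qed.

(** [G] bounds every competing curve from below and the segment gives the upper bound. The segment
    also shows that the set of lengths is nonempty, without which its [inf] would be a default
    value. *)
Lemma dist_to_bounds (U H : set V) (G dG : R -> R) (p : V) (M : R) :
  (forall s : R, is_derive s 1 G (dG s)) -> continuous dG ->
  (forall x, U x -> `|dG (tcoord x)| * f x <= 1) ->
  (forall q, H q -> tcoord q = 0) -> H (flatten_t p 1) ->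
  (forall s, 0 <= s <= 1 -> U (flatten_t p s) /\ (f (flatten_t p s))^-1 <= M) ->
  `|G (tcoord p) - G 0| <= dist_to g U H p <= M * `|tcoord p|.
Proof.
move=> dGP cdG GU H0 Hp /segment_length[L cL LM].
have lbG : lbound [set L | exists q, H q /\ curve_in g U p q L] `|G (tcoord p) - G 0|.
  move=> K [q [Hq cK]]; rewrite -(H0 _ Hq) distrC.
  exact: curve_length_ge dGP cdG GU cK.
apply/andP; split; first by apply: lb_le_inf => //; exists L, (flatten_t p 1).
apply: le_trans LM; apply: ge_inf; last by exists (flatten_t p 1).
by exists `|G (tcoord p) - G 0|.
Qed.

End curves.

(** * Estimates on planes *)

(* [|(w.x) y - (w.y) x|^2], that is [gram x y] times the squared norm of the
   projection of [w] to the plane spanned by [x] and [y]. *)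
Definition wedge_sq (R : realType) n (w x y : 'rV[R]_n) : R :=
  dotmul w x ^+ 2 * dotmul y y + dotmul w y ^+ 2 * dotmul x x
  - 2 * dotmul w x * dotmul w y * dotmul x y.

Section wedge.
Context {R : realType} {n : nat}.
Implicit Types (w x y : 'rV[R]_n).

Lemma dotmul_delta i x : dotmul (delta_mx 0 i) x = x 0 i.
Proof.
rewrite /dotmul -[RHS](sum_delta (fun j => x 0 j)).
by apply: eq_bigr => j _; rewrite mxE eqxx.
Qed.

Lemma gram_neq0_free x y : gram x y != 0 -> free [:: x; y].
Proof.
move=> g0; rewrite free_cons span_seq1 free_cons span_nil memv0 nil_free andbT.
apply/andP; split; apply: contra g0.
  move=> /vlineP[k ->]; have -> : k *: y = k *: y + 0 *: y by rewrite scale0r addr0.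
  by rewrite /gram !(dotmulDl, dotmulDr); apply/eqP; ring.
move=> /eqP ->; have -> : 0 = 0 *: x + 0 *: x by rewrite !scale0r addr0.
by rewrite /gram !(dotmulDl, dotmulDr); apply/eqP; ring.
Qed.

(** This is the shape of the Hessian on both sides of the hypersurface. The product of w (x) w with
    the Euclidean metric gives [wedge_sq w], and that of the identity gives twice [gram]. *)
Lemma kn_rank_one (a b c : R) w i0 x y :
  kn (fun i j => a * (w 0 i * w 0 j) + b * (i == j)%:R + c * ((i == i0)%:R * (j == i0)%:R)) x y
  = a * wedge_sq w x y + 2 * b * gram x y + c * wedge_sq (delta_mx 0 i0) x y.
Proof.
have Q u v : quad (fun i j => a * (w 0 i * w 0 j) + b * (i == j)%:R
    + c * ((i == i0)%:R * (j == i0)%:R)) u v =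
  a * (dotmul w u * dotmul w v) + b * dotmul u v + c * (u 0 i0 * v 0 i0).
  have -> : dotmul w u * dotmul w v = \sum_i \sum_j w 0 i * w 0 j * u 0 i * v 0 j.
    rewrite /dotmul mulr_suml; apply: eq_bigr => i _.
    by rewrite mulr_sumr; apply: eq_bigr => j _; ring.
  have -> : dotmul u v = \sum_i \sum_j (i == j)%:R * u 0 i * v 0 j.
    apply: eq_bigr => i _; under [RHS]eq_bigr do rewrite -mulrA.
    by rewrite sum_delta_sym.
  have -> : u 0 i0 * v 0 i0 = \sum_i \sum_j (i == i0)%:R * (j == i0)%:R * u 0 i * v 0 j.
    rewrite -(sum_delta (fun i => u 0 i * v 0 i0)); apply: eq_bigr => i _.
    rewrite -(sum_delta (fun j => v 0 j)) !mulr_sumr.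
    by apply: eq_bigr => j _; ring.
  rewrite !mulr_sumr -!big_split; apply: eq_bigr => i _.
  by rewrite !mulr_sumr -!big_split; apply: eq_bigr => j _ /=; ring.
rewrite /kn !Q /wedge_sq /gram !dotmul_delta; ring.
Qed.

(** The expression is |p y - q x|^2; multiplying by |y|^2 > 0 completes the square. *)
Lemma form_ge0 (p q : R) x y : 0 < gram x y ->
  0 <= p ^+ 2 * dotmul y y + q ^+ 2 * dotmul x x - 2 * p * q * dotmul x y.
Proof.
rewrite /gram; have := dotmul_ge0 x; have := dotmul_ge0 y.
set A := dotmul x x; set B := dotmul y y; set C := dotmul x y => B0 A0 g.
have {}B0 : 0 < B.
  rewrite lt_neqAle B0 andbT; apply/eqP => b0.
  by have := sqr_ge0 C; rewrite -b0 in g; lra.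
rewrite -(pmulr_rge0 _ B0).
have -> : B * (p ^+ 2 * B + q ^+ 2 * A - 2 * p * q * C) =
  (p * B - q * C) ^+ 2 + q ^+ 2 * (A * B - C ^+ 2) by ring.
by rewrite addr_ge0 ?sqr_ge0 // mulr_ge0 ?sqr_ge0 // ltW.
Qed.

Lemma wedge_sq_ge0 w x y : 0 < gram x y -> 0 <= wedge_sq w x y.
Proof. exact: form_ge0. Qed.

Lemma wedge_sq_le w x y : 0 < gram x y -> wedge_sq w x y <= dotmul w w * gram x y.
Proof.
move=> g.
(* [a *: x + b *: y] is [gram x y] times the orthogonal projection of [w] to the plane, so [E]
   computes the squared length of the normal remainder. *)
pose a := dotmul w x * dotmul y y - dotmul w y * dotmul x y.
pose b := dotmul w y * dotmul x x - dotmul w x * dotmul x y.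
have E : dotmul (gram x y *: w + (-1) *: (a *: x + b *: y))
    (gram x y *: w + (-1) *: (a *: x + b *: y)) =
    gram x y * (dotmul w w * gram x y - wedge_sq w x y).
  rewrite !(dotmulDl, dotmulDr) (dotmulC x w) (dotmulC y w) (dotmulC y x).
  by rewrite /a /b /wedge_sq /gram; ring.
by move: (dotmul_ge0 (gram x y *: w + (-1) *: (a *: x + b *: y))); rewrite E pmulr_rge0 // subr_ge0.
Qed.

(** Young's inequality |A + B|^2 >= k/(1+k) |A|^2 - k |B|^2: after multiplication by 1 + k the
    difference is |A + (1+k) B|^2. A small k keeps only a share k of the first term but also charges
    only k for the second. *)
Lemma wedge_sq_add_ge (a b k : R) (e z : 'rV[R]_n) x y : 0 < gram x y -> 0 <= k ->
  k / (1 + k) * a ^+ 2 * wedge_sq e x y - k * b ^+ 2 * wedge_sq z x y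
  <= wedge_sq (a *: e + b *: z) x y.
Proof.
move=> g k0; have k1 : 0 < 1 + k by lra.
rewrite -(ler_pM2l k1) -subr_ge0.
have := form_ge0 (a * dotmul e x + (1 + k) * (b * dotmul z x))
  (a * dotmul e y + (1 + k) * (b * dotmul z y)) g.
rewrite /wedge_sq !dotmulDl; congr (0 <= _).
by field; rewrite gt_eqF.
Qed.

End wedge.

(** * The conformal factor *)

Section cfactor.
Context {R : realType} {n : nat}.
Notation V := 'rV[R]_n.+1.
Implicit Types (p x : V).

Definition z_sq (p : V) : R := \sum_(i < n) p 0 (lift ord0 i) ^+ 2.

(* The metric is [f^-2] times the Euclidean one, with [f = cfactor]. *)
Definition cfactor (p : V) : R :=
  1 + flat_fun 0 (tcoord p) * expR (z_sq p) - flat_fun 0 (- tcoord p).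

Definition cfactor_d1 (i : 'I_n.+1) (p : V) : R :=
  let t := tcoord p in
  if i == ord0 then flat_fun 2 t * expR (z_sq p) + flat_fun 2 (- t)
  else 2 * p 0 i * (flat_fun 0 t * expR (z_sq p)).

Definition cfactor_d2 (i j : 'I_n.+1) (p : V) : R :=
  let t := tcoord p in
  let E := expR (z_sq p) in
  if i == ord0 then
    if j == ord0 then
      (flat_fun 4 t - 2 * flat_fun 3 t) * E - (flat_fun 4 (- t) - 2 * flat_fun 3 (- t))
    else 2 * p 0 j * (flat_fun 2 t * E)
  else
    if j == ord0 then 2 * p 0 i * (flat_fun 2 t * E)
    else (4 * p 0 i * p 0 j + 2 * (i == j)%:R) * (flat_fun 0 t * E).

Lemma cfactor_gt0 p : 0 < cfactor p.
Proof.
rewrite /cfactor; have [t0|t0] := leP 0 (tcoord p).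
  rewrite (flat_npos 0 (t := - tcoord p)) ?oppr_le0 // subr0.
  by rewrite ltr_wpDr // mulr_ge0 ?flat_ge0 ?expR_ge0.
rewrite (flat_npos 0 (ltW t0)) mul0r addr0 flat_pos ?oppr_gt0 // expr0 mul1r.
by rewrite subr_gt0 expR_lt1 oppr_lt0 invr_gt0 oppr_gt0.
Qed.

Lemma elementary_z_sq : elementary z_sq.
Proof.
rewrite /z_sq; elim: (index_enum _) => [|i r IH].
  rewrite (_ : (fun p => _) = (fun=> 0)); first exact: elementary_cst.
  by apply/funext => p; rewrite big_nil.
rewrite (_ : (fun p => _) = (fun p : V => p 0 (lift ord0 i) * p 0 (lift ord0 i)
  + \sum_(j <- r) p 0 (lift ord0 j) ^+ 2)).
  by apply: elementary_add IH; apply: elementary_mul; apply: elementary_coord.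
by apply/funext => p; rewrite big_cons expr2.
Qed.

Lemma elementary_cfactor : elementary cfactor.
Proof.
rewrite (_ : cfactor = (fun p => (1 + flat_fun 0 (p 0 ord0) * expR (z_sq p))
    + (-1) * flat_fun 0 ((-1) * p 0 ord0))).
  apply: elementary_add; first apply: elementary_add; first exact: elementary_cst.
    apply: elementary_mul; first exact/elementary_flat/elementary_coord.
    exact/elementary_exp/elementary_z_sq.
  apply: elementary_mul; first exact: elementary_cst.
  apply/elementary_flat/elementary_mul; last exact: elementary_coord.
  exact: elementary_cst.
by apply/funext => p; rewrite /cfactor !mulN1r.
Qed.

Lemma elementary_potential : elementary (fun p => - ln (cfactor p)).
Proof.
rewrite (_ : (fun p => _) = (fun p => (-1) * ln (cfactor p))).
  apply: elementary_mul; first exact: elementary_cst.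
  by apply: elementary_ln; [exact: elementary_cfactor | exact: cfactor_gt0].
by apply/funext => p; rewrite mulN1r.
Qed.

Lemma cfactor_continuous : continuous cfactor.
Proof.
by move=> p; apply/differentiable_continuous/elementary_differentiable/elementary_cfactor.
Qed.

Let dt (j : 'I_n.+1) (x : V) :
  is_derive x (delta_mx 0 j : V) (@tcoord R n) (j == ord0)%:R.
Proof. by have := is_derive_coord x (delta_mx 0 j : V) ord0; rewrite mxE /= eq_sym. Qed.

Let dtN (j : 'I_n.+1) (x : V) :
  is_derive x (delta_mx 0 j : V) (fun p => - tcoord p) (- (j == ord0)%:R).
Proof. exact: (is_deriveN (dt j x)). Qed.

Let dz (j : 'I_n.+1) (x : V) :
  is_derive x (delta_mx 0 j : V) z_sq (if j == ord0 then 0 else 2 * x 0 j).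
Proof.
have H := is_derive_sum (fun i : 'I_n => is_deriveM
  (is_derive_coord x (delta_mx 0 j : V) (lift ord0 i))
  (is_derive_coord x (delta_mx 0 j : V) (lift ord0 i))).
have zE : z_sq = \sum_(i < n) ((fun p : V => p 0 (lift ord0 i)) * (fun p : V => p 0 (lift ord0 i))).
  by apply/funext => p; rewrite fct_sumE; apply: eq_bigr => i _; rewrite expr2.
rewrite -zE in H.
apply: (is_derive_eq H); case: (unliftP ord0 j) => [j'|] ->.
  rewrite (bigD1 j') //= big1 => [|i ij].
    by rewrite !mxE !eqxx /GRing.scale /=; ring.
  by rewrite !mxE eqxx /= (inj_eq lift_inj) (negbTE ij) /GRing.scale /= !mulr0 addr0.
by rewrite eqxx big1 // => i _; rewrite !mxE /GRing.scale /= !mulr0 addr0.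
Qed.

Let dE (j : 'I_n.+1) (x : V) :
  is_derive x (delta_mx 0 j : V) (fun p => expR (z_sq p))
   (expR (z_sq x) * if j == ord0 then 0 else 2 * x 0 j).
Proof. exact: (is_derive_comp1 (dz j x) (is_derive_expR _)). Qed.

Let dflat k (j : 'I_n.+1) (x : V) :
  is_derive x (delta_mx 0 j : V) (fun p => flat_fun k (tcoord p))
   ((flat_fun k.+2 (tcoord x) - k%:R * flat_fun k.+1 (tcoord x)) * (j == ord0)%:R).
Proof. exact: (is_derive_comp1 (dt j x) (is_derive_flat _ _)). Qed.

Let dflatN k (j : 'I_n.+1) (x : V) :
  is_derive x (delta_mx 0 j : V) (fun p => flat_fun k (- tcoord p))
   ((flat_fun k.+2 (- tcoord x) - k%:R * flat_fun k.+1 (- tcoord x)) * - (j == ord0)%:R).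
Proof. exact: (is_derive_comp1 (dtN j x) (is_derive_flat _ _)). Qed.

Lemma is_derive_cfactor (i : 'I_n.+1) (x : V) :
  is_derive x (delta_mx 0 i) cfactor (cfactor_d1 i x).
Proof.
apply: (is_derive_eq (is_deriveB (is_deriveD (is_derive_cst (1 : R) x (delta_mx 0 i))
  (is_deriveM (dflat 0 i x) (dE i x))) (dflatN 0 i x))).
by rewrite /cfactor_d1 /GRing.scale /=; case: (i == ord0) => /=; ring.
Qed.

Lemma is_derive_cfactor_d1 (i j : 'I_n.+1) (x : V) :
  is_derive x (delta_mx 0 j) (cfactor_d1 i) (cfactor_d2 i j x).
Proof.
rewrite /cfactor_d1 /cfactor_d2; case: (eqVneq i ord0) => [_|i0].
  apply: (is_derive_eq (is_deriveD (is_deriveM (dflat 2 j x) (dE j x)) (dflatN 2 j x))).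
  by rewrite /GRing.scale /=; case: (j == ord0) => /=; ring.
apply: (is_derive_eq (is_deriveM (is_deriveZ 2 (is_derive_coord x (delta_mx 0 j : V) i))
  (is_deriveM (dflat 0 j x) (dE j x)))).
rewrite /GRing.scale /= mxE eqxx /=; case: (eqVneq j ord0) => [j0|j0] /=.
  by rewrite j0 (negbTE i0) !fctE /GRing.scale /=; ring.
by rewrite !fctE /GRing.scale /=; ring.
Qed.

Lemma cfactor_d2C (i j : 'I_n.+1) (x : V) : cfactor_d2 i j x = cfactor_d2 j i x.
Proof.
rewrite /cfactor_d2; case: ifP => i0; case: ifP => j0 //.
by rewrite (eq_sym i j); ring.
Qed.

Lemma cfactor_neg (p : V) : tcoord p < 0 ->
  [/\ cfactor p = 1 - flat_fun 0 (- tcoord p),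
      \sum_i cfactor_d1 i p ^+ 2 = flat_fun 2 (- tcoord p) ^+ 2
    & forall X Y, kn (fun i j => cfactor_d2 i j p) X Y =
        - (flat_fun 4 (- tcoord p) - 2 * flat_fun 3 (- tcoord p)) *
        wedge_sq (delta_mx 0 ord0) X Y].
Proof.
move=> t0; have z k : flat_fun k (tcoord p) = 0 by rewrite flat_npos // ltW.
split=> [||X Y].
- by rewrite /cfactor z mul0r addr0.
- rewrite (bigD1 ord0) //= big1 => [|i i0].
    by rewrite /cfactor_d1 eqxx z mul0r add0r addr0.
  by rewrite /cfactor_d1 (negbTE i0) z mul0r mulr0 expr0n.
set a := - _.
rewrite (_ : (fun i j => _) = (fun i j => 0 * ((0 : V) 0 i * (0 : V) 0 j) + 0 * (i == j)%:R
  + a * ((i == ord0)%:R * (j == ord0)%:R))); last first.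
  apply/funext => i; apply/funext => j; rewrite /cfactor_d2 !z /a.
  by case: (i == ord0); case: (j == ord0) => /=; ring.
by rewrite kn_rank_one; ring.
Qed.

Definition log_grad (p : V) : V :=
  (tcoord p)^-1 ^+ 2 *: delta_mx 0 ord0 + 2 *: \row_i (if i == ord0 then 0 else p 0 i).

Lemma dotmul_z (p : V) :
  dotmul (\row_i (if i == ord0 then 0 else p 0 i) : V) (\row_i (if i == ord0 then 0 else p 0 i))
  = z_sq p.
Proof.
rewrite /dotmul big_ord_recl !mxE eqxx mul0r add0r.
by apply: eq_bigr => i _; rewrite !mxE /= expr2.
Qed.

Lemma log_grad_sq (p : V) : dotmul (log_grad p) (log_grad p) = (tcoord p)^-1 ^+ 4 + 4 * z_sq p.
Proof.
rewrite /log_grad; set zp := \row_i _; pose e : V := delta_mx 0 ord0.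
have ee : dotmul e e = 1 by rewrite dotmul_delta mxE !eqxx.
have ez : dotmul e zp = 0 by rewrite dotmul_delta mxE eqxx.
rewrite !(dotmulDl, dotmulDr) -/e (dotmulC zp) ee ez dotmul_z; ring.
Qed.

(** The matrix diag(-2 t^-3, 2, .., 2) is written as 2 Id minus 2 + 2 t^-3 in the t-direction, to
    fit [kn_rank_one]; the part 2 Id produces the term [4 * gram X Y]. *)
Lemma cfactor_pos (p : V) : 0 < tcoord p ->
  let F := flat_fun 0 (tcoord p) * expR (z_sq p) in
  [/\ cfactor p = 1 + F,
      \sum_i cfactor_d1 i p ^+ 2 = F ^+ 2 * dotmul (log_grad p) (log_grad p)
    & forall X Y, kn (fun i j => cfactor_d2 i j p) X Y =
        F * (wedge_sq (log_grad p) X Y + 4 * gram X Y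
         - (2 + 2 * (tcoord p)^-1 ^+ 3) * wedge_sq (delta_mx 0 ord0) X Y)].
Proof.
move=> t0 F; have z k : flat_fun k (- tcoord p) = 0.
  by rewrite flat_npos // oppr_le0 ltW.
have fk k : flat_fun k (tcoord p) = (tcoord p)^-1 ^+ k * flat_fun 0 (tcoord p).
  by rewrite !flat_pos // expr0 mul1r.
have wE i : log_grad p 0 i = if i == ord0 then (tcoord p)^-1 ^+ 2 else 2 * p 0 i.
  rewrite !mxE eqxx /=; case: (i == ord0) => /=; ring.
split=> [||X Y].
- by rewrite /cfactor z subr0.
- rewrite /dotmul mulr_sumr; apply: eq_bigr => i _.
  rewrite wE /cfactor_d1 z (fk 2) /F; case: ifP => _; ring.
rewrite (_ : (fun i j => _) = (fun i j => F * (log_grad p 0 i * log_grad p 0 j)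
  + (2 * F) * (i == j)%:R
  + (- F * (2 + 2 * (tcoord p)^-1 ^+ 3)) * ((i == ord0)%:R * (j == ord0)%:R))); last first.
  apply/funext => i; apply/funext => j.
  rewrite !wE /cfactor_d2 !z (fk 4) (fk 3) (fk 2) /F.
  case: (eqVneq i ord0) => [iE|i0]; case: (eqVneq j ord0) => [jE|j0].
  - by rewrite iE jE eqxx /=; ring.
  - by rewrite iE eq_sym (negbTE j0) /=; ring.
  - by rewrite jE (negbTE i0) /=; ring.
  - rewrite /=; ring.
by rewrite kn_rank_one; ring.
Qed.

Lemma cfactor_zero (p : V) : tcoord p = 0 ->
  (forall i, cfactor_d1 i p = 0) /\ (forall i j, cfactor_d2 i j p = 0).
Proof.
move=> t0; rewrite /cfactor_d1 /cfactor_d2 t0 oppr0.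
have z k : flat_fun k (0 : R) = 0 by rewrite flat_npos.
by split=> [i|i j]; rewrite !z; repeat case: ifP => _; rewrite ?mul0r ?mulr0; ring.
Qed.

End cfactor.

(** * Sectional curvatures of the constructed metric *)

Section estimates.
Context {R : realType} {n : nat}.
Notation V := 'rV[R]_n.+1.
Implicit Types (p X Y : V).

(** Uniform bounds over all planes control the infimum from below and the supremum from above; one
    test plane for each gives the opposite bounds. *)
Lemma delta_sec_bounds (g : V -> 'M[R]_n.+1) p (a a' b b' : R) : 0 < a -> 0 < b' ->
  (forall X Y, free [:: X; Y] -> a <= `|sectional g p X Y| <= b) ->
  (exists X Y, free [:: X; Y] /\ `|sectional g p X Y| <= a') ->
  (exists X Y, free [:: X; Y] /\ b' <= `|sectional g p X Y| ) ->
  a / b <= delta_sec g p <= a' / b'.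
Proof.
move=> a0 b'0 ab [X [Y [XY hX]]] [X' [Y' [XY' hX']]].
have S0 : abs_sec_values g p !=set0 by exists `|sectional g p X Y|, X, Y.
have lS : lbound (abs_sec_values g p) a by move=> _ [A [B [AB ->]]]; have /andP[] := ab A B AB.
have uS : ubound (abs_sec_values g p) b by move=> _ [A [B [AB ->]]]; have /andP[] := ab A B AB.
have i1 : a <= inf (abs_sec_values g p) by exact: lb_le_inf.
have i2 : inf (abs_sec_values g p) <= a'.
  by apply: le_trans hX; apply: ge_inf; [exists a | exists X, Y].
have s1 : sup (abs_sec_values g p) <= b by exact: ge_sup.
have s2 : b' <= sup (abs_sec_values g p).
  by apply: le_trans hX' _; apply: ub_le_sup; [exists b | exists X', Y'].
have s0 : 0 < sup (abs_sec_values g p) by exact: lt_le_trans s2.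
have b0 : 0 < b by exact: lt_le_trans s1.
rewrite /delta_sec; apply/andP; split; apply: ler_pM => //.
- exact: ltW.
- by rewrite invr_ge0 ltW.
- by rewrite lef_pV2.
- by apply: ltW; exact: lt_le_trans i1.
- by rewrite invr_ge0 ltW.
- by rewrite lef_pV2.
Qed.

Let g : V -> 'M[R]_n.+1 := conformal_metric (fun p => - ln (cfactor p)).

Lemma sectional_cfactor p X Y : free [:: X; Y] ->
  sectional g p X Y = cfactor p * (kn (fun i j => cfactor_d2 i j p) X Y / gram X Y)
    - \sum_i cfactor_d1 i p ^+ 2.
Proof.
move=> XY; apply: (sectional_conformal (f1 := @cfactor_d1 R n) (f2 := @cfactor_d2 R n)).
- exact: cfactor_gt0.
- by move=> i x; exact: is_derive_cfactor.
- by move=> i j x; exact: is_derive_cfactor_d1.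
- by move=> i j x; exact: cfactor_d2C.
- by rewrite gt_eqF // gram_gt0.
Qed.

Lemma Rm_cfactor_zero p : tcoord p = 0 -> Rm_vanishes g p.
Proof.
move=> /cfactor_zero[z1 z2].
apply: (Rm_conformal0 (f1 := @cfactor_d1 R n) (f2 := @cfactor_d2 R n)) => //.
- exact: cfactor_gt0.
- by move=> i x; exact: is_derive_cfactor.
- by move=> i j x; exact: is_derive_cfactor_d1.
- by move=> i j x; exact: cfactor_d2C.
Qed.

Section planes.
Variables (i1 i2 : 'I_n.+1).
Hypotheses (i10 : i1 != ord0) (i20 : i2 != ord0) (i12 : i1 != i2).

Let e (i : 'I_n.+1) : V := delta_mx 0 i.

Lemma dotmul_e i j : dotmul (e i) (e j) = (i == j)%:R.
Proof. by rewrite dotmul_delta mxE eqxx /=. Qed.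

(* The planes of least |K| are taken in this form: [a = b = 0] for t < 0, and for
   t > 0 the values that make the plane orthogonal to [log_grad]. *)
Lemma gram_tilted (a b : R) :
  gram (1 *: e i1 + a *: e ord0) (1 *: e i2 + b *: e ord0) = 1 + a ^+ 2 + b ^+ 2.
Proof.
rewrite /gram !(dotmulDl, dotmulDr) !dotmul_e !eqxx (negbTE i12) (negbTE i10) (negbTE i20).
by rewrite !(eq_sym ord0) (negbTE i10) (negbTE i20) /=; ring.
Qed.

Lemma free_tilted (a b : R) : free [:: 1 *: e i1 + a *: e ord0; 1 *: e i2 + b *: e ord0].
Proof.
apply: gram_neq0_free; rewrite gram_tilted gt_eqF // -addrA.
by rewrite ltr_wpDr // addr_ge0 ?sqr_ge0.
Qed.

Lemma gram_vertical : gram (e ord0) (e i1) = 1.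
Proof. by rewrite /gram !dotmul_e !eqxx eq_sym (negbTE i10) /=; ring. Qed.

Lemma free_vertical : free [:: e ord0; e i1].
Proof. by apply: gram_neq0_free; rewrite gram_vertical oner_neq0. Qed.

(** * The negative side *)

Section negative.
Variable p : V.
Hypotheses (t0 : tcoord p < 0) (t1 : - (1 / 2000) < tcoord p).

Let s := - tcoord p.
Let q X Y := wedge_sq (delta_mx 0 ord0) X Y / gram X Y.
Let em := flat_fun 0 s.

Let s0 : 0 < s. Proof. by rewrite /s oppr_gt0. Qed.
Let s1 : s < 1 / 2000. Proof. by rewrite /s; rewrite ltrNl. Qed.
Let e0 : 0 < em. Proof. by rewrite /em flat_pos // expr0 mul1r expR_gt0. Qed.
Let e1 : em <= 2 * s ^+ 2. Proof. exact: (flat_bound 0 1 (ltW s0)). Qed.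
Let s2 : s ^+ 2 <= s / 2000.
Proof. by rewrite expr2; have := ltW s1; rewrite -(ler_pM2l s0); lra. Qed.

Lemma neg_sectional X Y : free [:: X; Y] ->
  sectional g p X Y = - (em * (s^-1 ^+ 4 * ((1 - em) * (1 - 2 * s) * q X Y + em))).
Proof.
move=> XY; rewrite sectional_cfactor //; have [-> -> ->] := cfactor_neg t0.
rewrite -/s -/em.
have fk k : flat_fun k s = s^-1 ^+ k * em by rewrite /em !flat_pos // expr0 mul1r.
rewrite (fk 4) (fk 3) (fk 2) /q; have := s0 => sp.
have := gram_gt0 XY => gp.
by field; rewrite !gt_eqF.
Qed.

Let q01 X Y : free [:: X; Y] -> 0 <= q X Y <= 1.
Proof.
move=> /gram_gt0 gp; rewrite /q divr_ge0 ?wedge_sq_ge0 ?(ltW gp) //=.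
by rewrite ler_pdivrMr // (le_trans (wedge_sq_le _ gp)) // dotmul_delta mxE !eqxx /=.
Qed.

Let c1 : 0 < (1 - em) * (1 - 2 * s).
Proof. by apply: mulr_gt0; have := s1; have := e1; have := s2; lra. Qed.

Lemma neg_sec_neg : sec_neg g p.
Proof.
move=> X Y XY; rewrite neg_sectional // oppr_lt0.
apply: mulr_gt0 => //; apply: mulr_gt0; first by rewrite exprn_gt0 // invr_gt0.
have /andP[h0 _] := q01 XY.
by apply: ltr_wpDl => //; apply: mulr_ge0 => //; exact: ltW.
Qed.

Lemma neg_delta_sec : delta_sec g p = em / (1 - 2 * s * (1 - em)).
Proof.
pose c := em * s^-1 ^+ 4.
have c0 : 0 < c by rewrite mulr_gt0 // exprn_gt0 // invr_gt0.
have KE X Y : free [:: X; Y] -> `|sectional g p X Y| =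
    c * ((1 - em) * (1 - 2 * s) * q X Y + em).
  move=> XY; have := neg_sec_neg XY => /ltr0_norm ->.
  by rewrite neg_sectional // opprK mulrA.
have d0 : 0 < (1 - em) * (1 - 2 * s) + em by apply: addr_gt0.
have -> : em / (1 - 2 * s * (1 - em)) = (c * em) / (c * ((1 - em) * (1 - 2 * s) + em)).
  have -> : (1 - em) * (1 - 2 * s) + em = 1 - 2 * s * (1 - em) by ring.
  by rewrite -mulf_div divff ?mul1r // gt_eqF.
(* The bounds over all planes are attained by the test planes, so the lower and upper estimates
   coincide and give an equality. *)
apply/eqP; rewrite eq_le andbC; apply: delta_sec_bounds; try by apply: mulr_gt0.
- move=> X Y XY; rewrite KE // !ler_pM2l //.
  have /andP[h0 h1] := q01 XY; rewrite lerDr lerD2r mulr_ge0 ?(ltW c1) //=.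
  by rewrite -[leRHS]mulr1 ler_pM2l.
(* A plane orthogonal to d/dt has q = 0, the minimum of the affine function of q. *)
- exists (1 *: e i1 + 0 *: e ord0), (1 *: e i2 + 0 *: e ord0).
  split; first exact: free_tilted.
  rewrite KE ?free_tilted // /q.
  rewrite /wedge_sq !dotmul_delta !mxE !eqxx /=.
  rewrite !(eq_sym ord0) (negbTE i10) (negbTE i20) /=.
  by rewrite ler_pM2l // le_eqVlt; apply/orP; left; apply/eqP; ring.
(* A plane containing d/dt has q = 1, the maximum. *)
- exists (e ord0), (e i1); split; first exact: free_vertical.
  rewrite KE ?free_vertical // /q gram_vertical.
  rewrite /wedge_sq !dotmul_delta !mxE !eqxx /= !(eq_sym ord0) (negbTE i10) /=.
  by rewrite ler_pM2l // le_eqVlt; apply/orP; left; apply/eqP; field.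
Qed.

Lemma neg_delta_gt0 : 0 < delta_sec g p.
Proof.
rewrite neg_delta_sec divr_gt0 //.
have -> : 1 - 2 * s * (1 - em) = (1 - em) * (1 - 2 * s) + em by ring.
exact: addr_gt0.
Qed.

(** The lower bound rests on (1 - y) e^{2y} >= (1 - y)(1 + 2y) = 1 + y (1 - 2y) >= 1. *)
Lemma ln_onem_bounds (y : R) : 0 <= y <= 1 / 2 -> - (2 * y) <= ln (1 - y) <= 0.
Proof.
move=> /andP[y0 y1]; rewrite ln_le0 ?andbT; last lra.
rewrite -[leLHS]expRK ler_ln ?posrE ?expR_gt0 //; last lra.
rewrite expRN -[leLHS]mul1r ler_pdivrMr ?expR_gt0 //.
have h := expR_ge1Dx (2 * y); have y2 : 0 <= 1 - y by lra.
by apply: le_trans (ler_wpM2l y2 h); nra.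
Qed.

(** Since s - d = O(s^3), the difference 1/d - 1/s is O(s), at most 8 s here. The logarithm of the
    denominator in [neg_delta_sec] costs another 4 s, and s <= 2 d turns 12 s into 24 d. *)
Lemma neg_error d : s * (1 - s ^+ 2) <= d <= (1 - 2 * s ^+ 2)^-1 * s ->
  `|ln (delta_sec g p) + 1 / d| <= 24 * d.
Proof.
move=> /andP[dl du].
have sq0 : 0 <= s ^+ 2 by exact: sqr_ge0.
have hd : s / 2 <= d.
  by apply: le_trans dl; rewrite ler_pM2l //; have := s1; have := s2; have := s0; lra.
have d0 : 0 < d by apply: lt_le_trans hd; have := s0; lra.
have y01 : 0 <= 2 * s * (1 - em) <= 1 / 2.
  have := s1; have := e1; have := s2; have := s0; have := e0 => *.
  apply/andP; split; first by apply: mulr_ge0; lra.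
  nra.
have y2 : 2 * s * (1 - em) <= 2 * s by have := s0; have := e0 => *; nra.
have [yl yu] := andP (ln_onem_bounds y01).
rewrite neg_delta_sec ln_div ?posrE //; last first.
  by have := s1; have := e1; have := s2; have := s0; have := e0 => *; nra.
have -> : ln em = - s^-1 by rewrite /em flat_pos // expr0 mul1r expRK.
have D : 1 / d - s^-1 = (s - d) / (s * d).
  by have sp := s0; field; rewrite !gt_eqF.
have B : `|(s - d) / (s * d)| <= 8 * s.
  rewrite normrM [`|(s * d)^-1|]ger0_norm; last by rewrite invr_ge0 ltW // mulr_gt0.
  rewrite ler_pdivrMr ?mulr_gt0 //.
  have m0 : 0 < 1 - 2 * s ^+ 2 by have := s1; have := s2; lra.
  rewrite mulrC ler_pdivlMr // in du.
  have k1 : 0 <= s * s ^+ 2 by apply: mulr_ge0 => //; exact: ltW.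
  have k2 : 4 * (s * s ^+ 2) <= 8 * s * (s * d).
    have -> : 8 * s * (s * d) = 8 * s ^+ 2 * d by ring.
    have : 8 * s ^+ 2 * (s / 2) <= 8 * s ^+ 2 * d by apply: ler_wpM2l => //; lra.
    lra.
  have k3 : d <= s * 2.
    have : s <= s * 2 * (1 - 2 * s ^+ 2).
      by rewrite -mulrA ler_peMr ?(ltW s0) //; have := s1; have := s2; lra.
    by move=> h; rewrite -(ler_pM2r m0); apply: le_trans du h.
  have k4 : d * s ^+ 2 <= s * 2 * s ^+ 2 by apply: ler_wpM2r.
  rewrite ler_norml; apply/andP; split; lra.
have -> : - s^-1 - ln (1 - 2 * s * (1 - em)) + 1 / d =
  (s - d) / (s * d) - ln (1 - 2 * s * (1 - em)) by rewrite -D; ring.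
apply: (le_trans (ler_normB _ _)).
have : `|ln (1 - 2 * s * (1 - em))| <= 4 * s by rewrite ler_norml; apply/andP; split; lra.
by move: B; lra.
Qed.

End negative.

(** * The positive side *)

Section positive.
Variable p : V.
Hypotheses (t0 : 0 < tcoord p) (t1 : tcoord p < 1 / 2000) (z1 : z_sq p <= 1 / 4).

Let t := tcoord p.
Let F := flat_fun 0 t * expR (z_sq p).
Let ti := t^-1 ^+ 4.

Lemma pos_scale_gt0 : 0 < F.
Proof. by rewrite /F flat_pos // expr0 mul1r mulr_gt0 ?expR_gt0. Qed.

(** The size of the slab comes from here: [flat_bound] gives 6! t^6 and e^{|z|^2} is at most 2, so t
    < 1/2000 makes 1440 t less than 1. The exponent 5 leaves one power of t after multiplication by
    t^-4. *)
Lemma pos_scale_le : F <= t ^+ 5.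
Proof.
have E2 : expR (z_sq p) <= 2.
  have h := expR_ge1Dx (- z_sq p); rewrite expRN in h.
  have : 1 / 2 <= (expR (z_sq p))^-1 by move: h z1; lra.
  by rewrite -[leRHS]mul1r ler_pdivlMr ?expR_gt0 //; lra.
have h : flat_fun 0 t <= 720 * t ^+ 6.
  apply: le_trans (flat_bound 0 5 (ltW t0)) _.
  by rewrite (_ : (0 + 5).+1`! = 720%N).
have h0 : 0 <= flat_fun 0 t := flat_ge0 _ _.
have t5 : 0 < t ^+ 5 by rewrite exprn_gt0.
apply: (@le_trans _ _ (720 * t ^+ 6 * 2)); first exact: ler_pM (expR_ge0 _) h E2.
rewrite exprS (_ : 720 * _ * 2 = (1440 * t) * t ^+ 5); last by ring.
apply: ler_piMl; first exact: ltW.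
have t1' : t < 1 / 2000 := t1.
by move: t1'; lra.
Qed.

Let F0 := pos_scale_gt0.
Let F5 := pos_scale_le.
Let ti0 : 0 < ti. Proof. by rewrite exprn_gt0 // invr_gt0. Qed.
Let tt : 0 < t := t0.
Let tn0 : t != 0. Proof. by rewrite gt_eqF. Qed.
Let tle : t <= 1 / 2000. Proof. exact: ltW t1. Qed.
Let t5ti : t ^+ 5 * ti = t. Proof. by rewrite /ti; field. Qed.
Let t5t : t ^+ 5 <= t.
Proof. by rewrite exprS ler_piMr ?(ltW tt) // exprn_ile1 ?(ltW tt) //; move: tle; lra. Qed.
Let zsq0 : 0 <= z_sq p. Proof. by apply: sumr_ge0 => i _; exact: sqr_ge0. Qed.
Let ti3 : 10 <= t^-1 ^+ 3.
Proof.
have h : 10 <= t^-1 by rewrite -[leRHS]mul1r ler_pdivlMr; [move: tle; lra | exact: tt].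
have h2 : 1 <= t^-1 ^+ 2 by rewrite expr2; move: h; nra.
by rewrite exprS; move: h h2; nra.
Qed.

(** This is |df|^2 / F. Its size O(t) makes the gradient term harmless even on planes where the
    Hessian contributes only about 4 F. *)
Let grad_small : F * dotmul (log_grad p) (log_grad p) <= 2 * t.
Proof.
rewrite log_grad_sq -/t -/ti.
apply: (@le_trans _ _ (t ^+ 5 * (ti + 1))); last by rewrite mulrDr t5ti mulr1; move: t5t; lra.
apply: ler_pM => //; first exact: ltW.
  by apply: addr_ge0; [exact: ltW | move: zsq0; lra].
by move: z1; lra.
Qed.

Let N X Y := (wedge_sq (log_grad p) X Y + 4 * gram X Y
  - (2 + 2 * t^-1 ^+ 3) * wedge_sq (delta_mx 0 ord0) X Y) / gram X Y.

Lemma pos_sectional X Y : free [:: X; Y] ->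
  sectional g p X Y = F * ((1 + F) * N X Y - F * dotmul (log_grad p) (log_grad p)).
Proof.
move=> XY; rewrite sectional_cfactor //; have [-> -> ->] := cfactor_pos t0.
by rewrite -/t -/F /N; ring.
Qed.

Let N_le X Y : free [:: X; Y] -> N X Y <= ti + 5.
Proof.
move=> /gram_gt0 gp; rewrite /N ler_pdivrMr //.
have := wedge_sq_le (log_grad p) gp; rewrite log_grad_sq -/t -/ti => h.
have h2 : 0 <= (2 + 2 * t^-1 ^+ 3) * wedge_sq (delta_mx 0 ord0) X Y.
  by apply: mulr_ge0; [move: ti3; lra | exact: wedge_sq_ge0].
have h3 : (ti + 4 * z_sq p) * gram X Y <= (ti + 1) * gram X Y.
  by rewrite ler_pM2r //; move: z1; lra.
by move: h h2 h3; lra.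
Qed.

(** Young's inequality with k = 3 t: the share k/(1+k) t^-4, about 3 t^-3, beats the unfavourable 2
    + 2 t^-3, and the price 4 k |z|^2 is at most 3 t because |z|^2 <= 1/4. *)
Let N_ge X Y : free [:: X; Y] -> 4 - 3 * t <= N X Y.
Proof.
move=> /gram_gt0 gp; rewrite /N ler_pdivlMr //.
pose zp : V := \row_i (if i == ord0 then 0 else p 0 i).
have k0 : 0 <= 3 * t by move: tt; lra.
have := wedge_sq_add_ge (t^-1 ^+ 2) 2 (delta_mx 0 ord0) zp gp k0.
rewrite -[_ + 2 *: zp]/(log_grad p).
have := wedge_sq_le zp gp; rewrite dotmul_z => hz.
have W0 := wedge_sq_ge0 (delta_mx 0 ord0) gp.
set W := wedge_sq (delta_mx 0 ord0) X Y in W0 *.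
have c : 2 + 2 * t^-1 ^+ 3 <= 3 * t / (1 + 3 * t) * (t^-1 ^+ 2) ^+ 2.
  have -> : 3 * t / (1 + 3 * t) * (t^-1 ^+ 2) ^+ 2 = 3 * t^-1 ^+ 3 / (1 + 3 * t).
    by have h : 1 + 3 * t != 0 by [rewrite gt_eqF //; move: tt; lra]; field; rewrite h.
  by rewrite ler_pdivlMr; move: ti3 tt tle; nra.
have {}c : (2 + 2 * t^-1 ^+ 3) * W <= 3 * t / (1 + 3 * t) * (t^-1 ^+ 2) ^+ 2 * W.
  exact: ler_wpM2r.
have hz2 : 3 * t * 2 ^+ 2 * wedge_sq zp X Y <= 3 * t * gram X Y.
  have : z_sq p * gram X Y <= 1 / 4 * gram X Y by rewrite ler_pM2r.
  by move=> h; have h' := le_trans hz h; move: h' tt; nra.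
by move: c hz2; lra.
Qed.

Let K_ge X Y : free [:: X; Y] -> F * (4 - 5 * t) <= sectional g p X Y.
Proof.
move=> XY; rewrite pos_sectional // ler_pM2l //.
have h := N_ge XY; have h4 : 0 <= F * N X Y.
  by apply: mulr_ge0; [exact: ltW | move: h tle; lra].
by move: h h4 grad_small; lra.
Qed.

Let K_gt0 X Y : free [:: X; Y] -> 0 < sectional g p X Y.
Proof. by move=> /K_ge; apply: lt_le_trans; apply: mulr_gt0 => //; move: tle; lra. Qed.

Let grad_ge0 : 0 <= F * dotmul (log_grad p) (log_grad p).
Proof. by apply: mulr_ge0; [exact: ltW | exact: dotmul_ge0]. Qed.

Lemma pos_sec_pos : sec_pos g p.
Proof. exact: K_gt0. Qed.

Let Ft : F <= t. Proof. exact: le_trans F5 t5t. Qed.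

Let titi : t * ti = t^-1 ^+ 3. Proof. by rewrite /ti; field. Qed.

Lemma pos_delta_sec :
  (4 - 9 * t) * t ^+ 4 <= delta_sec g p <= (4 + 20 * t) * t ^+ 4.
Proof.
have tip : 10 <= t * ti by rewrite titi.
have : (F * (4 - 5 * t)) / (F * ((1 + t) * ti)) <= delta_sec g p <=
  (F * (4 + 4 * t)) / (F * ((1 - 3 * t) * ti)).
  apply: delta_sec_bounds.
  - by apply: mulr_gt0 => //; move: tle; lra.
  - by apply: mulr_gt0 => //; apply: mulr_gt0 => //; move: tle; lra.
  (* (1 + F)(t^-4 + 5) exceeds t^-4 by less than 10, and t times t^-4 is at least 10; hence the
     factor 1 + t. *)
  - move=> X Y XY; rewrite ger0_norm ?(ltW (K_gt0 XY)) // K_ge //= pos_sectional //.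
    rewrite ler_pM2l //.
    have hN := N_le XY; have hF : F * N X Y <= F * (ti + 5) by rewrite ler_pM2l.
    have hF2 : F * ti <= t by rewrite -t5ti ler_pM2r.
    by move: grad_ge0 hN hF hF2 Ft tip tle; lra.
  (* The coefficient c of d/dt solves t^-2 c + 2 z_i = 0. The [log_grad] term of [N] then vanishes,
     leaving 4 minus a nonnegative quantity. *)
  - exists (1 *: e i1 + (- 2 * t ^+ 2 * p 0 i1) *: e ord0).
    exists (1 *: e i2 + (- 2 * t ^+ 2 * p 0 i2) *: e ord0).
    set X := _ + _; set Y := _ + _.
    have XY : free [:: X; Y] by exact: free_tilted.
    have gp := gram_gt0 XY.
    have orth i a : i != ord0 -> a = p 0 i ->
        dotmul (log_grad p) (1 *: e i + (- 2 * t ^+ 2 * a) *: e ord0) = 0.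
      move=> i0 ->; rewrite dotmulC dotmulDl !dotmul_delta !mxE eqxx /= (negbTE i0) -/t.
      by rewrite /=; field.
    split=> //; rewrite ger0_norm ?(ltW (K_gt0 XY)) // pos_sectional // ler_pM2l //.
    have N4 : N X Y <= 4.
      rewrite /N ler_pdivrMr // /wedge_sq !orth // -/(wedge_sq _ X Y).
      have : 0 <= (2 + 2 * t^-1 ^+ 3) * wedge_sq (delta_mx 0 ord0) X Y.
        by apply: mulr_ge0; [move: ti3; lra | exact: wedge_sq_ge0].
      by lra.
    have FN : F * N X Y <= F * 4 by rewrite ler_pM2l.
    by move: grad_ge0 FN N4 Ft; lra.
  (* This plane contains d/dt, which carries the dominant component t^-2 of [log_grad]; the loss 2
     t^-3 is 2 t relative to t^-4. *)
  - exists (e ord0), (e i1); have XY := free_vertical; split=> //.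
    rewrite ger0_norm ?(ltW (K_gt0 XY)) // pos_sectional // ler_pM2l //.
    have N3 : ti - 2 * t^-1 ^+ 3 <= N (e ord0) (e i1).
      rewrite /N gram_vertical divr1 /wedge_sq.
      rewrite ![dotmul (log_grad p) _]dotmulC !dotmul_delta !mxE !eqxx /=.
      rewrite !(eq_sym ord0) (negbTE i10) /= -/t /ti.
      by have := sqr_ge0 (2 * p 0 i1); lra.
    have FN : 0 <= F * N (e ord0) (e i1).
      by apply: mulr_ge0; [exact: ltW | apply: le_trans (N_ge XY); move: tle; lra].
    by move: grad_small N3 FN titi tip tle; lra.
have cancel a b : 0 < b -> (F * a) / (F * (b * ti)) = a / b * t ^+ 4.
  by move=> b0; rewrite /ti; field; rewrite !gt_eqF.
rewrite !cancel; [|by move: tle; lra|by move: tt; lra].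
have t4 : 0 < t ^+ 4 by rewrite exprn_gt0.
move=> /andP[h1 h2]; apply/andP; split.
  apply: le_trans h1; rewrite ler_pM2r // ler_pdivlMr; last by move: tt; lra.
  by move: tt tle; nra.
apply: le_trans h2 _; rewrite ler_pM2r // ler_pdivrMr; last by move: tle; lra.
by move: tt tle; nra.
Qed.

(** Since t (1 - t) <= d <= t, d^4 agrees with t^4 up to a relative error 4 t. The quotient then
    lies between 4 - 9 t and 4 + 40 t, and t <= 2 d gives 80 d. *)
Lemma pos_error d : t * (1 - t ^+ 2) <= d <= t ->
  `|delta_sec g p / d ^+ 4 - 4| <= 80 * d.
Proof.
move=> /andP[dl du].
have t2 : t ^+ 2 <= t / 2000 by rewrite expr2; move: tt tle; nra.
have hd : t * (1 - t) <= d by apply: le_trans dl; rewrite ler_pM2l //; move: t2 tt; lra.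
have d0 : 0 < d by apply: lt_le_trans hd; apply: mulr_gt0 => //; move: tle; lra.
have t4 : 0 < t ^+ 4 by rewrite exprn_gt0.
have d4 : 0 < d ^+ 4 by rewrite exprn_gt0.
have du4 : d ^+ 4 <= t ^+ 4 by rewrite lerXn2r // nnegrE ltW.
have dl4 : t ^+ 4 * (1 - 4 * t) <= d ^+ 4.
  apply: (@le_trans _ _ ((t * (1 - t)) ^+ 4)).
    rewrite exprMn ler_pM2l //.
    have -> : (1 - t) ^+ 4 = (1 - 4 * t) + t ^+ 2 * (6 - 4 * t + t ^+ 2) by ring.
    by rewrite lerDl mulr_ge0 ?sqr_ge0 //; have := sqr_ge0 t; move: tle; lra.
  by rewrite lerXn2r // nnegrE ?(ltW d0) // ltW // mulr_gt0 //; move: tle; lra.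
have /andP[h1 h2] := pos_delta_sec.
have u : delta_sec g p / d ^+ 4 <= 4 + 40 * t.
  rewrite ler_pdivrMr //; apply: le_trans h2 _.
  apply: (@le_trans _ _ ((4 + 40 * t) * (t ^+ 4 * (1 - 4 * t)))).
    rewrite [leRHS]mulrCA mulrC ler_pM2l //; move: tt tle; nra.
  by rewrite ler_pM2l //; move: tt; lra.
have l : 4 - 9 * t <= delta_sec g p / d ^+ 4.
  rewrite ler_pdivlMr //; apply: le_trans h1.
  by rewrite ler_pM2l //; move: tle; lra.
have d2 : t <= 2 * d by move: hd tt tle; nra.
by rewrite ler_norml; apply/andP; split; lra.
Qed.

End positive.
End planes.
End estimates.

(** * Geometry of the slab and distance to the hypersurface *)

Section slab.
Context {R : realType} {n : nat}.
Notation V := 'rV[R]_n.+1.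
Implicit Types (p : V).

Lemma slabE (t1 t2 r : R) p : 0 < r ->
  slab t1 t2 r p <-> t1 < tcoord p < t2 /\ z_sq p < r ^+ 2.
Proof.
move=> r0; rewrite /slab /= /euclidean_norm.
have -> : \sum_i zcoord p 0 i ^+ 2 = z_sq p by apply: eq_bigr => i _; rewrite mxE.
suff -> : (Num.sqrt (z_sq p) < r) = (z_sq p < r ^+ 2) by [].
by rewrite -{1}(ger0_norm (ltW r0)) -sqrtr_sqr ltr_sqrt // exprn_gt0.
Qed.

Lemma z_sqZ (s : R) p : z_sq (s *: p) = s ^+ 2 * z_sq p.
Proof. by rewrite /z_sq mulr_sumr; apply: eq_bigr => i _; rewrite mxE exprMn. Qed.

Lemma tcoordZ (s : R) p : tcoord (s *: p) = s * tcoord p.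
Proof. by rewrite /tcoord mxE. Qed.

Lemma slab_star (t1 t2 r : R) p (s : R) : t1 < 0 < t2 -> 0 < r -> 0 <= s <= 1 ->
  slab t1 t2 r p -> slab t1 t2 r (s *: p).
Proof.
move=> /andP[t10 t20] r0 /andP[s0 s1] /(slabE _ _ _ r0)[/andP[a b] c]; apply/slabE => //.
rewrite z_sqZ tcoordZ; split.
  apply/andP; split.
    have [h|h] := leP 0 (tcoord p); first by apply: lt_le_trans t10 _; exact: mulr_ge0.
    by apply: lt_le_trans a _; move: h s1; nra.
  have [h|h] := leP 0 (tcoord p); last by apply: le_lt_trans t20; rewrite mulr_ge0_le0 // ltW.
  by apply: le_lt_trans b; rewrite ler_piMl.
apply: le_lt_trans c; rewrite ler_piMl ?exprn_ile1 //.
by apply: sumr_ge0 => i _; exact: sqr_ge0.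
Qed.

Lemma slab_connected (t1 t2 r : R) : t1 < 0 < t2 -> 0 < r ->
  connected (@slab R n t1 t2 r).
Proof.
move=> t12 r0.
have -> : @slab R n t1 t2 r =
    \bigcup_(p in slab t1 t2 r) ((fun s : R => s *: p) @` `[0, 1]).
  apply/seteqP; split=> [p Up|p [q Uq [s /=]]].
    by exists p => //; exists 1; rewrite ?scale1r //= in_itv /= lexx ler01.
  by rewrite in_itv /= => s01 <-; exact: slab_star.
apply: bigcup_connected.
  by exists 0 => p Up; exists 0; rewrite ?scale0r //= in_itv /= lexx ler01.
move=> p Up; apply: connected_continuous_connected; first exact: segment_connected.
by apply: continuous_subspaceT => s; apply: cvgZr_tmp; apply: cvg_id.
Qed.

Lemma tcoord_flatten p (s : R) : tcoord (flatten_t p s) = (1 - s) * tcoord p.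
Proof. by rewrite /flatten_t {1}/tcoord !mxE !eqxx /= -/(tcoord p); ring. Qed.

Lemma z_sq_flatten p (s : R) : z_sq (flatten_t p s) = z_sq p.
Proof. by apply: eq_bigr => i _; rewrite !mxE /= !mulr0 addr0. Qed.

Let t1 : R := - (1 / 2000).
Let t2 : R := 1 / 2000.
Let r : R := 1 / 2.
Let U := @slab R n t1 t2 r.
Let H := @hypersurface R n t1 t2 r.
Let g : V -> 'M[R]_n.+1 := conformal_metric (fun p => - ln (cfactor p)).

Let r0 : 0 < r. Proof. by rewrite /r; lra. Qed.
Let t12 : t1 < 0 < t2. Proof. by rewrite /t1 /t2; apply/andP; split; lra. Qed.

Lemma z_sq_slab p : U p -> z_sq p <= 1 / 4.
Proof.
move=> /(slabE _ _ _ r0)[_ /ltW h]; apply: le_trans h _.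
by rewrite /r expr2; lra.
Qed.

Let tabs p : U p -> t1 < tcoord p < t2.
Proof. by move=> /(slabE _ _ _ r0)[]. Qed.

Lemma cfactor_npos p : tcoord p <= 0 -> cfactor p = 1 - flat_fun 0 (- tcoord p).
Proof. by move=> t0; rewrite /cfactor (flat_npos 0 t0) mul0r addr0. Qed.

(* [t - t^3] is 1-Lipschitz for the metric, and agrees with [t] to second order. *)
Lemma lipschitz_slab p : U p -> `|1 - 3 * tcoord p ^+ 2| * cfactor p <= 1.
Proof.
move=> Up; have /andP[a b] := tabs Up; rewrite /t1 /t2 in a b.
set t := tcoord p in a b *; have q0 := sqr_ge0 t.
have q1 : t ^+ 2 <= 1 / 4 by rewrite expr2; move: a b; nra.
have c0 := ltW (cfactor_gt0 p).
rewrite ger0_norm; last by move: q1; lra.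
have [t0|t0] := leP t 0.
  have c1 : cfactor p <= 1 by rewrite cfactor_npos // lerBlDr lerDl flat_ge0.
  by rewrite -[leRHS]mulr1; apply: ler_pM => //; move: q0 q1; lra.
(* Here f > 1, so t itself is not 1-Lipschitz. The excess F <= t^5 <= t^2 is paid for by the cubic
   correction: (1 - 3 t^2)(1 + t^2) <= 1. *)
have [-> _ _] := cfactor_pos t0.
have h := pos_scale_le t0 b (z_sq_slab Up); rewrite -/t in h *.
have h2 : t ^+ 5 <= t ^+ 2.
  rewrite -[5%N]/(2 + 3)%N exprD ler_piMr // exprn_ile1 ?(ltW t0) //.
  by move: b; lra.
set F := flat_fun 0 t * _ in h *.
by move: q0 q1 h h2 => *; nra.
Qed.

Lemma dist_slab p (M : R) : U p ->
  (forall s, 0 <= s <= 1 -> (cfactor (flatten_t p s))^-1 <= M) ->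
  `|tcoord p| * (1 - tcoord p ^+ 2) <= dist_to g U H p <= M * `|tcoord p|.
Proof.
move=> Up hM; have /andP[a b] := tabs Up; rewrite /t1 /t2 in a b.
have Us s : 0 <= s <= 1 -> U (flatten_t p s).
  move=> /andP[s0 s1]; apply/(slabE _ _ _ r0).
  have [_ hz] := (slabE _ _ _ r0).1 Up.
  rewrite tcoord_flatten z_sq_flatten; split=> //.
  have s01 : 0 <= 1 - s <= 1 by apply/andP; split; lra.
  (* Only the t-bounds are taken: (1 - s) p has the same t-coordinate as the point of the
     segment. *)
  by have := slab_star t12 r0 s01 Up; move=> /(slabE _ _ _ r0)[]; rewrite tcoordZ.
have q1 : tcoord p ^+ 2 <= 1 by rewrite expr2; move: a b; nra.
have -> : `|tcoord p| * (1 - tcoord p ^+ 2) =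
    `|(tcoord p - tcoord p ^+ 3) - (0 - 0 ^+ 3)|.
  rewrite expr0n /= !subr0 (_ : tcoord p - tcoord p ^+ 3 = tcoord p * (1 - tcoord p ^+ 2)); last by ring.
  by rewrite normrM [X in _ = _ * X]ger0_norm // subr_ge0.
apply: (@dist_to_bounds _ _ _ (@cfactor_gt0 R n) (@cfactor_continuous R n) U H
  (fun s => s - s ^+ 3) (fun s => 1 - 3 * s ^+ 2)).
- move=> s; apply: DeriveDef.
    apply: derivableB; first exact: derivable_id.
    exact: exprn_derivable.
  rewrite deriveB; [|exact: derivable_id|exact: exprn_derivable].
  by rewrite derive_id exp_derive /GRing.scale /= mulr1.
- move=> s; apply: cvgB; first exact: cvg_cst.
  by apply: cvgM; [exact: cvg_cst | exact: exprn_continuous].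
- exact: lipschitz_slab.
- by move=> q [].
- by split; [apply: Us; rewrite ler01 lexx | rewrite /= tcoord_flatten subrr mul0r].
- by move=> s s01; split; [exact: Us | exact: hM].
Qed.

(** Along the segment f >= 1 - 2 s^2 by [flat_bound] at order 2, so its length exceeds s only by
    O(s^3). *)
Lemma dist_neg p : U p -> tcoord p < 0 ->
  (- tcoord p) * (1 - (- tcoord p) ^+ 2) <= dist_to g U H p
    <= (1 - 2 * (- tcoord p) ^+ 2)^-1 * (- tcoord p).
Proof.
move=> Up t0; have /andP[a b] := tabs Up; rewrite /t1 /t2 in a b.
rewrite sqrrN -(ltr0_norm t0); apply: dist_slab => // s /andP[s0 s1].
have q0 := sqr_ge0 (tcoord p).
have q1 : tcoord p ^+ 2 <= 1 / 4 by rewrite expr2; move: a b; nra.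
rewrite lef_pV2 ?posrE ?cfactor_gt0 //; last by move: q1; lra.
have h : 0 <= - ((1 - s) * tcoord p) by move: s1 t0 => *; nra.
rewrite cfactor_npos tcoord_flatten; last by move: h; lra.
rewrite lerD2l lerN2; apply: le_trans (flat_bound 0 1 h) _.
rewrite (_ : (0 + 1).+1`!%:R = 2 :> R) // ler_pM2l // sqrrN exprMn ler_piMl //.
by rewrite exprn_ile1 //; move: s0 s1; lra.
Qed.

(** For t >= 0 the factor f is at least 1, so the segment has length at most t. *)
Lemma dist_pos p : U p -> 0 < tcoord p ->
  tcoord p * (1 - tcoord p ^+ 2) <= dist_to g U H p <= tcoord p.
Proof.
move=> Up t0; have := @dist_slab p 1 Up; rewrite mul1r gtr0_norm //; apply.
move=> s /andP[s0 s1]; rewrite invf_le1 ?cfactor_gt0 // /cfactor.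
rewrite (flat_npos 0 (t := - _)) ?subr0 ?lerDl ?mulr_ge0 ?flat_ge0 ?expR_ge0 //.
by rewrite tcoord_flatten oppr_le0 mulr_ge0 ?(ltW t0) // subr_ge0.
Qed.

Lemma dist_pos_gt0 p : U p -> 0 < tcoord p -> 0 < dist_to g U H p.
Proof.
move=> Up t0; have /andP[h _] := dist_pos Up t0; apply: lt_le_trans h.
apply: mulr_gt0 => //; rewrite subr_gt0 expr_lt1 ?(ltW t0) //.
have /andP[_ b] := tabs Up; apply: lt_trans b _.
by rewrite /t2; lra.
Qed.

End slab.

Lemma halved_lt {R : realType} (a : R) :
  0 < a -> (- a < - (a / 2) < 0) /\ (0 < a / 2 < a).
Proof. by move=> a0; split; [apply/andP; split; lra|apply/andP; split; lra]. Qed.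

Lemma o1_uniform_linear (R : realType) (T : Type) (A : set T) (d w : T -> R) (C : R) :
  0 < C -> (forall p, A p -> `|w p| <= C * d p) -> o1_uniform A d w.
Proof.
move=> C0 h eps e0; exists (eps / C); first exact: divr_gt0.
move=> p Ap dp; apply: le_lt_trans (h p Ap) _.
by rewrite mulrC -ltr_pdivlMr.
Qed.

Unset Implicit Arguments.

(* The dimension of the ambient space is n.+1, and z ranges over R^n. *)
Theorem proposition4p1 (R : realType) (n : nat) (hn : (3 <= n.+1)%N) :
  exists (t1 t2 r : R) (u : 'rV[R]_n.+1 -> R),
    let U := @slab R n t1 t2 r in
    let H := @hypersurface R n t1 t2 r in
    let g := conformal_metric u in
    let d := dist_to g U H in
    [/\ t1 < 0 < t2, 0 < r, connected U & smooth_on U u] /\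
    [/\ sign_trichotomy g U,
        forall p, neg_side t1 t2 r p -> sec_neg g p,
        forall p, H p -> Rm_vanishes g p
      & forall p, pos_side t1 t2 r p -> sec_pos g p] /\
    exists wneg wpos : 'rV[R]_n.+1 -> R,
      [/\ forall p, neg_side t1 t2 r p ->
            delta_sec g p = expR (- (1 / d p) + wneg p),
          forall p, pos_side t1 t2 r p ->
            delta_sec g p = (4 + wpos p) * d p ^+ 4,
          o1_pointwise (neg_side t1 t2 r) d wneg
        & o1_pointwise (pos_side t1 t2 r) d wpos] /\
      exists s1 s2 rho : R,
        [/\ t1 < s1 < 0, 0 < s2 < t2, 0 < rho < r,
            o1_uniform (neg_side s1 s2 rho) d wneg
          & o1_uniform (pos_side s1 s2 rho) d wpos].
Proof.
have n0 : (0 < n)%N by exact: leq_ltn_trans (_ : 1 < n)%N.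
(* Two distinct transverse directions, available because the dimension is at least 3. *)
pose i1 : 'I_n.+1 := lift ord0 (Ordinal n0).
pose i2 : 'I_n.+1 := lift ord0 (Ordinal (hn : (1 < n)%N)).
have i10 : i1 != ord0 by rewrite eq_sym neq_lift.
have i20 : i2 != ord0 by rewrite eq_sym neq_lift.
have i12 : i1 != i2 by rewrite (inj_eq lift_inj).
exists (- (1 / 2000)), (1 / 2000), (1 / 2), (fun p => - ln (cfactor p)).
move=> U H g d.
have t12 : (- (1 / 2000) : R) < 0 < (1 / 2000 : R) by apply/andP; split; lra.
have r0 : 0 < 1 / 2 :> R by lra.
have tU p : U p -> - (1 / 2000) < tcoord p < 1 / 2000 by move=> [].
have hneg p : U p -> tcoord p < 0 -> sec_neg g p.
  by move=> /tU/andP[a _] t0; exact: neg_sec_neg.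
have hpos p : U p -> 0 < tcoord p -> sec_pos g p.
  by move=> Up t0; have /andP[_ b] := tU _ Up; exact: pos_sec_pos t0 b (z_sq_slab Up).
split; first split=> //.
- exact: slab_connected.
- exact/elementary_smooth/elementary_potential.
split; first split.
- move=> p Up; have [t0|t0|t0] := ltgtP (tcoord p) 0.
  + by apply: Or32; exact: hneg.
  + by apply: Or31; exact: hpos.
  + by apply: Or33; exact: Rm_cfactor_zero.
- by move=> p [Up t0]; exact: hneg.
- by move=> p [_ t0]; exact: Rm_cfactor_zero.
- by move=> p [Up t0]; exact: hpos.
(* The remainders are obtained by solving the two identities for them, which uses [delta_sec] > 0 on
   the negative side and d > 0 on the positive one. *)
exists (fun p => ln (delta_sec g p) + 1 / d p), (fun p => delta_sec g p / d p ^+ 4 - 4).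
pose NS : set 'rV[R]_n.+1 := neg_side (- (1 / 2000)) (1 / 2000) (1 / 2).
pose PS : set 'rV[R]_n.+1 := pos_side (- (1 / 2000)) (1 / 2000) (1 / 2).
have Bneg p : NS p -> `|ln (delta_sec g p) + 1 / d p| <= 24 * d p.
  move=> [Up t0]; have /andP[a _] := tU _ Up.
  exact: (neg_error i10 i20 i12 t0 a (dist_neg Up t0)).
have Bpos p : PS p -> `|delta_sec g p / d p ^+ 4 - 4| <= 80 * d p.
  move=> [Up t0]; have /andP[_ b] := tU _ Up.
  exact: (pos_error i10 i20 i12 t0 b (z_sq_slab Up) (dist_pos Up t0)).
split.
  split.
  - move=> p [Up t0]; have /andP[a _] := tU _ Up.
    rewrite addrCA addNr addr0 lnK // posrE.
    exact: (neg_delta_gt0 i10 i20 i12 t0 a).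
  - move=> p [Up t0]; have /andP[_ b] := tU _ Up.
    have d0 : 0 < d p by exact: dist_pos_gt0 Up t0.
    by rewrite addrC subrK divfK // expf_neq0 // gt_eqF.
  - by move=> z; apply: (o1_uniform_linear (C := 24)) => // p [] /Bneg.
  - by move=> z; apply: (o1_uniform_linear (C := 80)) => // p [] /Bpos.
have sub (a b c : R) p : - (1 / 2000) <= a -> b <= 1 / 2000 -> c <= 1 / 2 ->
    slab a b c p -> U p.
  move=> ha hb hc [/andP[h1 h2] h3]; split; last exact: lt_le_trans hc.
  by apply/andP; split; [exact: le_lt_trans h1 | exact: lt_le_trans hb].
have T0 : 0 < 1 / 2000 :> R by case/andP: t12.
have [T1 T2] := halved_lt T0; have [_ r1] := halved_lt r0.
have /andP[/ltW T1' _] := T1; have /andP[_ /ltW T2'] := T2; have /andP[_ /ltW r1'] := r1.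
(* The bounds linear in d hold on the whole slab with constants independent of z, so halving it in
   every direction gives an admissible smaller slab. *)
exists (- (1 / 2000 / 2)), (1 / 2000 / 2), (1 / 2 / 2); split; [exact: T1 | exact: T2 | exact: r1 | |].
- apply: (o1_uniform_linear (C := 24)) => // p [Up t0]; apply: Bneg; split=> //.
  exact: sub Up.
- apply: (o1_uniform_linear (C := 80)) => // p [Up t0]; apply: Bpos; split=> //.
  exact: sub Up.
Qed.
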